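(* Let $m,d\ge 1$ be integers, let $V=\{v(x),\ x\in\mathbb{R}^m\}$ be an $\mathbb{R}^d$-valued stochastic process with continuous sample paths, and let $I\subset\mathbb{R}^m$ be a compact set of positive Lebesgue measure. Fix $N>0$ and assume that $V$ satisfies the following two hypotheses: (1) For any $x,y\in I$ with $x\ne y$, the vector $(v(x),v(y))$ has a density $p_{x,y}$, and there exist $\gamma,\alpha\in\,]0,\infty[$ (not depending on $x,y$) such that $$p_{x,y}(z_1,z_2)\le \frac{C}{\|x-y\|^{\gamma}}\exp\left(-\frac{c\,\|z_1-z_2\|^2}{\|x-y\|^{\alpha}}\right)$$ for any $z_1,z_2\in[-N,N]^d$, where $C$ and $c$ are positive constants independent of $x$ and $y$. (2) One of the following two conditions holds: (P) the density $p_x$ of $v(x)$ is continuous and bounded, and $p_x(w)>0$ for any $x\in I$ and $w\in[-(N+1),N+1]^d$; (P$'$) for any compact set $K\subset\mathbb{R}^d$ and any $x\in I$, there is a constant $c_0>0$ such that $\inf_{w\in K}p_x(w)\ge c_0$, where $p_x$ is the density of $v(x)$. Then there exists a positive and finite constant $c=c(N,\alpha,\gamma,I,m)$ such that for all Borel sets $A\subset[-N,N]^d$, $$P\{v(I)\cap A\ne\varnothing\}\ \ge\ c\,\operatorname{Cap}_{\frac{2}{\alpha}(\gamma-m)}(A).$$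
   Context: $v(I)$ denotes the (random) image of $I$ under $x\mapsto v(x)$. $\|\cdot\|$ is the Euclidean norm. Bessel–Riesz kernels: for $\gamma\in\mathbb{R}$ and $r\ge 0$, $K_\gamma(r)=r^{-\gamma}$ if $\gamma>0$; $K_0(r)=\log(c_*/r)$; $K_\gamma(r)=1$ if $\gamma<0$ (with value $+\infty$ at $r=0$ when $\gamma\ge0$). Here $c_*$ is a fixed constant, chosen sufficiently large. For a Borel set $A\subset\mathbb{R}^d$, $\mathcal{P}(A)$ is the set of probability measures on $A$, and for $\mu\in\mathcal{P}(A)$, $\mathcal{E}_\gamma(\mu)=\int_A\int_A K_\gamma(\|x-y\|)\,\mu(dx)\,\mu(dy)$. The Bessel–Riesz capacity is $\operatorname{Cap}_\gamma(A)=\left[\inf_{\mu\in\mathcal{P}(A)}\mathcal{E}_\gamma(\mu)\right]^{-1}$, with the convention $1/\infty=0$ (in particular $\operatorname{Cap}_\gamma(\varnothing)=0$). The constant $c(N,\alpha,\gamma,I,m)$ in the conclusion does not depend on $A$; it may depend on the fixed process $V$ through the constants and densities in hypotheses (1) and (2). *)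

(* Defs.v *)
From HB Require Import structures.
From mathcomp Require Import all_boot all_order all_algebra.
From mathcomp Require Import all_classical all_reals all_analysis.

Set Implicit Arguments.
Unset Strict Implicit.
Unset Printing Implicit Defensive.

Import Order.TTheory GRing.Theory Num.Theory.
Import numFieldNormedType.Exports.

Local Open Scope classical_set_scope.
Local Open Scope ring_scope.

(* R^n is 'rV[R]_n, with the library's (product) topology and its Borel
   sigma-algebra. *)

HB.instance Definition _ (R : realType) (n : nat) :=
  @isMeasurable.Build (sigma_display (@open 'rV[R]_n)) 'rV[R]_n
    <<s @open 'rV[R]_n >>
    (@sigma_algebra0 _ setT _) (@sigma_algebraC _ _) (@sigma_algebra_bigcup _ setT _).

Section borel_rV.
Variables (R : realType).

Lemma open_measurable_rV n (A : set 'rV[R]_n) : open A -> measurable A.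
Proof. exact: sub_sigma_algebra. Qed.

Lemma measurable_coord n (i : 'I_n) :
  measurable_fun [set: 'rV[R]_n] (fun x : 'rV[R]_n => x ord0 i : R).
Proof.
apply: (@measurability _ _ _ _ _ _ (@measurable_realfun.RGenOpens.G R)); first exact: measurable_realfun.RGenOpens.measurableE.
move=> _ [_ [a [b ->]] <-]; rewrite setTI; apply: open_measurable_rV.
apply: open_comp; last exact: interval_open.
by move=> x _; exact: coord_continuous.
Qed.

Let qbox n (q : {ffun 'I_n -> rat * rat}) : set 'rV[R]_n :=
  [set x | forall i, ratr (q i).1 < x ord0 i < ratr (q i).2].

Let open_qbox n (A : set 'rV[R]_n) : open A ->
  A = \bigcup_(q in [set q : {ffun 'I_n -> rat * rat} | qbox q `<=` A]) qbox q.
Proof.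
move=> oA; apply/seteqP; split => [x Ax|x [q /= qA]]; last exact: qA.
have /nbhs_ballP[e /= e0 eA] : nbhs x A by exact: open_nbhs_nbhs.
have H (i : 'I_n) : {q : rat * rat |
    [/\ x ord0 i - e < ratr q.1, ratr q.1 < x ord0 i,
        x ord0 i < ratr q.2 & ratr q.2 < x ord0 i + e]}.
  have lt1 : x ord0 i - e < x ord0 i by rewrite ltrBlDr ltrDl.
  have lt2 : x ord0 i < x ord0 i + e by rewrite ltrDl.
  have := rat_in_itvoo lt1; move=> /cid[q1]; rewrite in_itv/= => /andP[q11 q12].
  have := rat_in_itvoo lt2; move=> /cid[q2]; rewrite in_itv/= => /andP[q21 q22].
  by exists (q1, q2).
exists [ffun i => sval (H i)] => [y yq|i]; last first.
  by rewrite ffunE; case: (H i) => -[q1 q2] /= [_ -> -> _].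
apply: eA; split => // i j; rewrite (ord1 i) /ball/=.
move: (yq j); rewrite ffunE; case: (H j) => -[q1 q2] /= [a1 a2 a3 a4] /andP[b1 b2].
rewrite distrC ltr_distl; apply/andP; split.
  exact: lt_trans b1.
exact: (lt_trans b2).
Qed.

Lemma measurable_fun_rV n d (T : measurableType d) (f : T -> 'rV[R]_n) :
  (forall i, measurable_fun setT (fun t => f t ord0 i : R)) ->
  measurable_fun setT f.
Proof.
move=> mf; apply: (@measurability _ _ _ _ _ _ (@open 'rV[R]_n)) => //.
move=> _ [A oA <-]; rewrite setTI (open_qbox oA) bigcup_mkcond preimage_bigcup.
apply: countable_bigcupT_measurable; first exact: countableP.
move=> q; case: ifPn => _; last by rewrite preimage_set0.
rewrite (_ : _ @^-1` _ = \bigcap_(i in [set: 'I_n])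
    (fun t => f t ord0 i : R) @^-1` `]ratr (q i).1, ratr (q i).2[%classic).
  apply: fin_bigcap_measurable => // i _.
  by rewrite -[X in measurable X]setTI; apply: mf => //; exact: measurable_itv.
apply/seteqP; split => [t /= H i _|t /= H i]; first by rewrite /= in_itv/=; exact: H.
by have := H i I; rewrite /= in_itv.
Qed.

End borel_rV.

Section lebesgue_rV.
Variable R : realType.

Definition rV_cons n (p : measurableTypeR R * 'rV[R]_n) : 'rV[R]_n.+1 :=
  row_mx (p.1 : R)%:M p.2 : 'rV[R]_(1 + n).

Lemma rV_cons0 n p : @rV_cons n p ord0 ord0 = p.1.
Proof.
have := row_mxEl ((p.1 : R)%:M : 'rV[R]_1) p.2 ord0 ord0.
rewrite [in RHS]mxE eqxx mulr1n => <-; congr (row_mx _ _ _ _); exact: val_inj.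
Qed.

Lemma rV_consS n p (i : 'I_n) : @rV_cons n p ord0 (lift ord0 i) = p.2 ord0 i.
Proof.
rewrite /rV_cons -[RHS](row_mxEr ((p.1 : R)%:M : 'rV[R]_1)).
congr (row_mx _ _ _ _); exact: val_inj.
Qed.

Definition rV_uncons n (x : 'rV[R]_n.+1) : measurableTypeR R * 'rV[R]_n :=
  (x ord0 ord0, \row_i x ord0 (lift ord0 i)).

Lemma rV_consK n : cancel (@rV_cons n) (@rV_uncons n).
Proof.
move=> [a x]; rewrite /rV_uncons rV_cons0; congr (_, _) => /=.
by apply/rowP => i; rewrite mxE rV_consS.
Qed.

Lemma measurable_rV_cons n : measurable_fun setT (@rV_cons n).
Proof.
apply: measurable_fun_rV => i; case: (unliftP ord0 i) => [j ->|->].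
  under eq_fun do rewrite rV_consS.
  exact: (measurableT_comp (measurable_coord j) measurable_snd).
under eq_fun do rewrite rV_cons0.
exact: measurable_fst.
Qed.

Lemma measurable_rV_uncons n : measurable_fun setT (@rV_uncons n).
Proof.
apply/measurable_fun_pairP; split; first exact: (measurable_coord ord0).
apply: measurable_fun_rV => i.
rewrite (_ : (fun _ => _) = fun x : 'rV[R]_n.+1 => x ord0 (lift ord0 i)).
  exact: measurable_coord.
by apply/funext => x /=; rewrite mxE.
Qed.

Section step.
Variables (n : nat) (nu : {sigma_finite_measure set 'rV[R]_n -> \bar R}).
Local Open Scope ereal_scope.

Definition lebesgue_cons : set 'rV[R]_n.+1 -> \bar R :=
  pushforward (lebesgue_measure \x nu) (@rV_cons n).

Let lebesgue_cons0 : lebesgue_cons set0 = 0.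
Proof. by rewrite /lebesgue_cons /pushforward preimage_set0 measure0. Qed.

Let lebesgue_cons_ge0 A : 0 <= lebesgue_cons A.
Proof. by rewrite /lebesgue_cons /pushforward; exact: measure_ge0. Qed.

Let lebesgue_cons_sigma_additive : semi_sigma_additive lebesgue_cons.
Proof.
move=> F mF tF mUF; rewrite /lebesgue_cons /pushforward preimage_bigcup.
apply: measure_semi_sigma_additive.
- by move=> k; rewrite -[X in measurable X]setTI; exact: measurable_rV_cons.
- apply/trivIsetP => /= i j _ _ ij; rewrite -preimage_setI.
  by move/trivIsetP : tF => /(_ _ _ _ _ ij) ->//; rewrite preimage_set0.
- by rewrite -preimage_bigcup -[X in measurable X]setTI; exact: measurable_rV_cons.
Qed.

HB.instance Definition _ := isMeasure.Build _ _ _ lebesgue_cons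
  lebesgue_cons0 lebesgue_cons_ge0 lebesgue_cons_sigma_additive.

Let lebesgue_cons_sigma_finite : sigma_finite setT lebesgue_cons.
Proof.
have /sigma_finiteP[F [TF ndF Foo]] := sigma_finiteT (@lebesgue_measure R).
have /sigma_finiteP[G [TG ndG Goo]] := sigma_finiteT nu.
exists (fun k => @rV_uncons n @^-1` (F k `*` G k)).
  rewrite -preimage_bigcup; apply/esym/seteqP; split => // x _.
  have [i _ Fi] : (\bigcup_i F i) (rV_uncons x).1 by rewrite -TF.
  have [j _ Gj] : (\bigcup_i G i) (rV_uncons x).2 by rewrite -TG.
  exists (maxn i j) => //; split => /=.
    by move: Fi; exact/subsetPset/ndF/leq_maxl.
  by move: Gj; exact/subsetPset/ndG/leq_maxr.
move=> k; have [mF Fk] := Foo k; have [mG Gk] := Goo k.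
have mFG : measurable (F k `*` G k) by exact: measurableX.
split; first by rewrite -[X in measurable X]setTI; exact: measurable_rV_uncons.
rewrite /lebesgue_cons /pushforward -comp_preimage.
rewrite (_ : _ \o _ = id); last by apply/funext => p /=; rewrite rV_consK.
by rewrite preimage_id product_measure1E// lte_mul_pinfty// ge0_fin_numE.
Qed.

HB.instance Definition _ := @Measure_isSigmaFinite.Build _ _ _ lebesgue_cons
  lebesgue_cons_sigma_finite.

End step.

Fixpoint lebesgue_rV n : {sigma_finite_measure set 'rV[R]_n -> \bar R} :=
  match n with
  | 0 => \d_(0 : 'rV[R]_0)
  | k.+1 => lebesgue_cons (lebesgue_rV k)
  end.

Lemma lebesgue_rV_box n (a b : 'rV[R]_n) : (forall i, a ord0 i <= b ord0 i) ->
  lebesgue_rV n [set x | forall i, x ord0 i \in `]a ord0 i, b ord0 i]] =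
  (\prod_(i < n) (b ord0 i - a ord0 i))%:E.
Proof.
elim: n a b => [a b _|n IHn a b ab].
  rewrite big_ord0 /= diracE mem_set//= => -[].
  by [].
rewrite big_ord_recl EFinM.
rewrite [X in lebesgue_rV _ X](_ : _ =
   @rV_uncons n @^-1` (`]a ord0 ord0, b ord0 ord0]%classic `*`
     [set x : 'rV[R]_n | forall i, x ord0 i \in
        `](rV_uncons a).2 ord0 i, (rV_uncons b).2 ord0 i]])); last first.
  apply/seteqP; split => [x /= H|x /= [H0 HS] i].
    split; first exact: H.
    by move=> i; rewrite !mxE.
  case: (unliftP ord0 i) => [j ->|-> //].
  by have := HS j; rewrite !mxE.
rewrite [LHS]/= /lebesgue_cons /pushforward -comp_preimage.
rewrite (_ : _ \o _ = id); last by apply/funext => p /=; rewrite rV_consK.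
rewrite preimage_id.
have mbox : measurable [set x : 'rV[R]_n | forall i, x ord0 i \in
        `](rV_uncons a).2 ord0 i, (rV_uncons b).2 ord0 i]].
  rewrite (_ : [set _ | _] = \bigcap_(i in [set: 'I_n])
      (fun x : 'rV[R]_n => x ord0 i : R) @^-1`
         `](rV_uncons a).2 ord0 i, (rV_uncons b).2 ord0 i]%classic).
    apply: fin_bigcap_measurable => // i _.
    by rewrite -[X in measurable X]setTI; apply: measurable_coord => //; exact: measurable_itv.
  by apply/seteqP; split => [x /= H i _|x /= H i]; [exact: H|exact: (H i I)].
rewrite product_measure1E //.
rewrite IHn; last by move=> i; rewrite !mxE.
congr (_ * _)%E.
  rewrite [LHS](lebesgue_measure_itv `]a ord0 ord0, b ord0 ord0])/= lte_fin.
  have := ab ord0; rewrite le_eqVlt => /predU1P[->|->]; last by rewrite EFinB.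
  by rewrite ltxx subrr.
by congr (_%:E); apply: eq_bigr => i _; rewrite !mxE.
Qed.

End lebesgue_rV.

Section notions.
Variable R : realType.

(* The norm of the library on 'rV[R]_n is the sup norm; this is the Euclidean
   one. *)
Definition enorm n (x : 'rV[R]_n) : R := Num.sqrt (\sum_(i < n) x ord0 i ^+ 2).

Definition cube n (N : R) : set 'rV[R]_n :=
  [set z | forall i, - N <= z ord0 i <= N].

Definition has_density disp (T : measurableType disp)
    (mu nu : set T -> \bar R) (p : T -> R) : Prop :=
  [/\ measurable_fun setT p, (forall z, 0 <= p z) &
      forall B, measurable B -> nu B = (\int[mu]_(z in B) (p z)%:E)%E].

(* For gamma = 0 the kernel is positive at r only when r < cstar; on
   cube n N this holds for all distances once cstar exceeds the diameter
   2 * N * Num.sqrt n%:R. *)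
Definition bessel_riesz_kernel (cstar gamma r : R) : \bar R :=
  if gamma < 0 then 1%E
  else if r == 0 then +oo%E
  else if gamma == 0 then (ln (cstar / r))%:E
  else (r `^ (- gamma))%:E.

Definition energy n (cstar gamma : R) (A : set 'rV[R]_n)
    (mu : set 'rV[R]_n -> \bar R) : \bar R :=
  (\int[mu]_(x in A) \int[mu]_(y in A)
     bessel_riesz_kernel cstar gamma (enorm (x - y)))%E.

(* A probability measure on the Borel set A is seen as a Borel probability
   measure on R^n giving mass 1 to A. On extended reals, +oo^-1 = 0 and
   ereal_inf set0 = +oo, so the capacity of the empty set is 0. *)
Definition capacity n (cstar gamma : R) (A : set 'rV[R]_n) : \bar R :=
  ((ereal_inf [set energy cstar gamma A mu |
     mu in [set mu : probability 'rV[R]_n R | mu A = 1%E]])^-1)%E.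

(* For a Borel set A, the event {v(I) meets A} is a projection of a measurable
   set: it belongs to the P-completion of the sigma-algebra, but not always to
   the sigma-algebra itself. The value at E of the completion of P, when
   defined, is the inner probability of E. *)
Definition inner_prob disp (T : measurableType disp) (P : probability T R)
    (E : set T) : \bar R :=
  ereal_sup [set P B | B in [set B | measurable B /\ B `<=` E]].

Lemma inner_probE disp (T : measurableType disp) (P : probability T R)
  (E : set T) : measurable E -> inner_prob P E = P E.
Proof.
move=> mE; apply/eqP; rewrite eq_le; apply/andP; split.
  apply: ge_ereal_sup => _ [B [mB BE] <-].
  by apply: le_measure => //; rewrite inE.
by apply: ereal_sup_ubound; exists E => //; split.
Qed.

(* For any completion of P (any N <= E <= M with N, M measurable and
   P N = P M), the inner probability is the completed one. *)
Lemma inner_prob_completion disp (T : measurableType disp)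
  (P : probability T R) (E N M : set T) :
  measurable N -> measurable M -> N `<=` E -> E `<=` M -> P N = P M ->
  inner_prob P E = P M.
Proof.
move=> mN mM NE EM PNM; apply/eqP; rewrite eq_le; apply/andP; split.
  apply: ge_ereal_sup => _ [B [mB BE] <-].
  by apply: le_measure; rewrite ?inE//; exact: subset_trans EM.
by rewrite -PNM; apply: ereal_sup_ubound; exists N.
Qed.

End notions.

(* Main.v *)
Require Import Defs.
From HB Require Import structures.
From mathcomp Require Import all_boot all_order all_algebra.
From mathcomp Require Import all_classical all_reals all_analysis.
From mathcomp Require Import measurable_realfun ring lra.

(** The proof is the second moment method. Write [b = 2 / alpha * (gamma - m)].
    Distances are measured in the sup norm, which is comparable to the Euclidean
    one.

    If [b >= d], every probability measure on a bounded subset of R^d has infinite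
    [b]-energy ([energy_ge_dim]), the capacity is 0 and there is nothing to prove.

    Suppose that [b < d], and let [mu] be a probability measure on [A] of finite
    energy. Up to a factor 4 in the energy, [mu] may be replaced by its restriction
    to a compact subset [F] of [A] that carries half of its mass
    ([compact_approx]). For small [e] consider the random variable
    [J_e], the measure of the pairs of a time [x] in [I] and a point [z] of [F],
    under Lebesgue measure times [mu], such that [v x] is within [e] of [z] and in
    the cube. If [J_e > 0] then the path comes within [e] of [F]; as [e] tends to
    0 the events [J_e > 0] decrease to an event on which the path hits [F]
    ([hit_limit]). So a bound from below on [P (J_e > 0)] that is uniform in [e]
    is enough, and Cauchy-Schwarz gives [P (J_e > 0) >= (E J_e)^2 / E (J_e)^2]
    ([second_moment], [hit_prob]).

    First moment. The densities of [v x] are bounded from below on the cube by a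
    positive constant that depends on [x]. After restricting the times to a
    subset of [I] of positive measure the constant becomes uniform
    ([good_times]), and [E J_e] is at least a multiple of [e ^ d].

    Second moment. [E (J_e)^2] is the integral over pairs of times [x], [y] and
    pairs of points [z1], [z2] of the probability that [v x] and [v y] are close
    to [z1] and [z2]. Put [s = |x - y|] and [q = max (|z1 - z2|, e)]. Integrating
    the density bound over two balls of radius [e] shows that this probability is
    at most a multiple of [e ^ (2 d)] times [s ^ (- gamma)], and also times
    [s ^ (- gamma) (s ^ (alpha / 2) / q) ^ th], for any [th] with [0 < th < d]
    ([rect_mass]). Integrating over [y], with the second bound for
    [s <= q ^ (2 / alpha)] and the first one beyond, yields at most a multiple of
    the Bessel-Riesz kernel of order [b] at [|z1 - z2|] as soon as [th > b]
    ([potential_le_bessel], [pair_time_integral]). Hence [E (J_e)^2] is at most a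
    multiple of [e ^ (2 d)] times the energy of [mu], the powers of [e] cancel,
    and [P (J_e > 0)] is at least a constant over the energy. Taking the infimum
    over [mu] gives the capacity ([capacity_le]). *)

Set Implicit Arguments.
Unset Strict Implicit.
Unset Printing Implicit Defensive.

Import Order.TTheory GRing.Theory Num.Theory.
Import numFieldNormedType.Exports.

Local Open Scope classical_set_scope.
Local Open Scope ring_scope.

(** * Second moment inequality *)

(** Monotonicity without measurability of the integrands: it follows from the
    definition of the integral as a supremum over simple functions, and it spares
    the measurability of every intermediate bound below. *)
Lemma ge0_integral_mono d (T : measurableType d) (R : realType)
  (mu : {measure set T -> \bar R}) (D : set T) (f g : T -> \bar R) :
  (forall x, D x -> 0 <= f x)%E -> (forall x, D x -> f x <= g x)%E ->
  (\int[mu]_(x in D) f x <= \int[mu]_(x in D) g x)%E.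
Proof.
move=> f0 fg; rewrite !(integral_mkcond D).
have f1 x : (0 <= (f \_ D) x)%E by rewrite patchE; case: ifPn => // /set_mem /f0.
have g1 x : (0 <= (g \_ D) x)%E.
  by rewrite patchE; case: ifPn => // /set_mem Dx; exact: le_trans (f0 _ Dx) (fg _ Dx).
rewrite !ge0_integralTE//; apply: le_ereal_sup => _ [h hf <-].
exists h => // x; apply: le_trans (hf x) _.
by rewrite !patchE; case: ifPn => // /set_mem /fg.
Qed.

(** The choice [b = e / S] is optimal; when [S = 0] any large [b] will do. *)
Lemma sqr_le_of_young (R : realType) (e S p : R) : 0 <= e -> 0 <= S -> 0 <= p ->
  (forall b, 0 < b -> 2 * e <= b * S + p / b) -> e ^+ 2 <= S * p.
Proof.
move=> e0 S0 p0 H; move: e0; rewrite le_eqVlt => /predU1P[<-|e0].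
  by rewrite expr0n/= mulr_ge0.
move: S0; rewrite le_eqVlt => /predU1P[S0|S0].
  have := H ((p + 1) / e); rewrite divr_gt0 ?ltr_wpDl// => /(_ isT).
  rewrite -S0 mulr0 add0r invf_div mulrA ler_pdivlMr ?ltr_wpDl//.
  by nra.
have := H (e / S); rewrite divr_gt0// => /(_ isT).
rewrite divfK ?gt_eqF// invf_div mulrA => h.
have : e <= p * S / e by lra.
by rewrite ler_pdivlMr// mulrC => h2; rewrite expr2 mulrC [S * p]mulrC.
Qed.

(** The Cauchy-Schwarz argument of Paley and Zygmund for [J w = nu (H^w)], the
    measure of the section of [H] at [w]. By Tonelli the first two moments of [J]
    are the integrals of [P (H_t)] and of [P (H_t n H_s)]. Cauchy-Schwarz itself is
    obtained by integrating [2 J <= b J^2 + 1_(J > 0) / b] and optimizing in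
    [b]. *)
Lemma second_moment d1 d2 (T1 : measurableType d1) (T2 : measurableType d2)
  (R : realType) (nu : {sigma_finite_measure set T1 -> \bar R})
  (P : {sigma_finite_measure set T2 -> \bar R}) (H : set (T1 * T2)) (e S p : R) :
  measurable H -> 0 <= e -> 0 <= S -> 0 <= p ->
  (e%:E <= \int[nu]_t P (xsection H t))%E ->
  (\int[nu]_t \int[nu]_s P (xsection H t `&` xsection H s) <= S%:E)%E ->
  (P [set w | 0 < nu (ysection H w)] <= p%:E)%E -> e ^+ 2 <= S * p.
Proof.
move=> mH e0 S0 p0 he hS hp.
pose J (w : T2) : \bar R := nu (ysection H w).
have mJ : measurable_fun setT J by exact: measurable_fun_ysection.
have J0 w : (0 <= J w)%E by exact: measure_ge0.
pose G := [set w | (0 < J w)%E].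
have mG : measurable G.
  have -> : G = J @^-1` `]0%E, +oo[%classic.
    by apply/seteqP; split => w; rewrite /G /= in_itv/= andbT.
  by rewrite -[X in measurable X]setTI; apply: mJ => //; exact: emeasurable_itv.
have E1 : (\int[nu]_t P (xsection H t) = \int[P]_w J w)%E.
  have := indic_fubini_tonelli nu P mH.
  under eq_integral do rewrite -/(fubini_F _ _ _) indic_fubini_tonelli_FE//.
  move=> /= ->.
  by under eq_integral do rewrite -/(fubini_G _ _ _) indic_fubini_tonelli_GE//.
have E2 : (\int[P]_w (J w * J w) = \int[nu]_t \int[nu]_s P (xsection H t `&` xsection H s))%E.
  pose f1 (q : T1 * T2) : \bar R := (\1_H q)%:E.
  have mf1 : measurable_fun setT f1 by apply/measurable_EFinP.
  have JE w : J w = (\int[nu]_t f1 (t, w))%E.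
    by rewrite -[RHS]/(fubini_G nu _ w) indic_fubini_tonelli_GE.
  transitivity (\int[P]_w \int[nu]_t (f1 (t, w) * J w))%E.
    apply: eq_integral => w _; rewrite {1}JE ge0_integralZr//.
      by apply: measurableT_comp => //; exact: measurable_pair2.
    by move=> t _; rewrite lee_fin.
  have -> := esym (fubini_tonelli (m1 := nu) (m2 := P) (fun q => f1 q * J q.2)%E _ _); first last.
  - by move=> q; rewrite mule_ge0// lee_fin.
  - apply: emeasurable_funM => //; exact: measurableT_comp.
  apply: eq_integral => t _ /=.
  transitivity (\int[P]_w \int[nu]_s (f1 (s, w) * f1 (t, w)))%E.
    apply: eq_integral => w _; rewrite muleC JE ge0_integralZr ?lee_fin//.
      by apply: measurableT_comp => //; exact: measurable_pair2.
    by move=> s _; rewrite lee_fin.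
  have -> := esym (fubini_tonelli (m1 := nu) (m2 := P) (fun q => f1 q * f1 (t, q.2))%E _ _); first last.
  - by move=> q; rewrite mule_ge0// lee_fin.
  - apply: emeasurable_funM => //.
    apply: (measurableT_comp mf1).
    exact: (measurableT_comp (measurable_pair1 t)).
  apply: eq_integral => s _ /=.
  have mHts : measurable (xsection H t `&` xsection H s).
    by apply: measurableI; exact: measurable_xsection.
  transitivity (\int[P]_w (\1_(xsection H t `&` xsection H s) w)%:E)%E; last first.
    by rewrite integral_indic// setIT.
  apply: eq_integral => w _; rewrite /f1 -EFinM; congr EFin.
  rewrite indicI /= mulrC /= !indicE !mem_xsection//.
(* integrate 2 J <= b J^2 + 1_G / b, i.e. (b J - 1)^2 >= 0 on G *)
apply: sqr_le_of_young => // b b0.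
have b0' := ltW b0.
have ib0 : (0 <= (b^-1)%:E)%E by rewrite lee_fin invr_ge0.
have bS : (\int[P]_w (b%:E * (J w * J w)) = b%:E * \int[P]_w (J w * J w))%E.
  rewrite ge0_integralZl//; first exact: emeasurable_funM.
  by move=> w _; rewrite mule_ge0.
have pG : (\int[P]_w ((b^-1)%:E * (\1_G w)%:E) = (b^-1)%:E * P G)%E.
  rewrite ge0_integralZl//; first by rewrite integral_indic// setIT.
  exact/measurable_EFinP.
rewrite -lee_fin EFinM.

apply: (@le_trans _ _ (\int[P]_w (2%:E * J w))%E).
  by rewrite ge0_integralZl// lee_pmul2l// -E1.
apply: (@le_trans _ _ (\int[P]_w (b%:E * (J w * J w) + (b^-1)%:E * (\1_G w)%:E))%E); last first.
  rewrite ge0_integralD//.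
  - rewrite bS pG EFinD !EFinM leeD//.
      by rewrite lee_pmul2l// E2.
    by rewrite muleC lee_pmul2r ?lte_fin ?invr_gt0.
  - by move=> w _; rewrite !mule_ge0.
  - by apply: measurable_funeM; exact: emeasurable_funM.
  - by move=> w _; rewrite mule_ge0// lee_fin ?invr_ge0.
  - by apply: measurable_funeM; exact/measurable_EFinP.
apply: ge0_integral_mono => w _; first by rewrite mule_ge0.
have := J0 w; rewrite indicE; case: (boolP (w \in G)) => [/set_mem|/negP].
  rewrite /G/=; case: (J w) => [r||]//.
    move=> _ _; rewrite -!EFinM -EFinD lee_fin mulr1.
    have : 0 <= b^-1 * (b * r - 1) ^+ 2 by rewrite mulr_ge0 ?invr_ge0// sqr_ge0.
    have -> : b^-1 * (b * r - 1) ^+ 2 = b * (r * r) - 2 * r + b^-1 by field; rewrite gt_eqF.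
    by rewrite -subr_ge0; move=> h; apply: le_trans h _; rewrite le_eqVlt; apply/orP; left; apply/eqP; ring.
  by move=> _ _; rewrite mulyy !gt0_muley ?lte_fin// mule1 addye// leey.
move=> wG Jw; have -> : J w = 0%E.
  apply/eqP; rewrite eq_le Jw andbT leNgt; apply/negP => Jw'; apply: wG.
  exact: mem_set.
by rewrite !mule0 adde0.
Qed.

(** * Integrals of powers of the distance *)

Section euclidean_space.
Context {R : realType}.

Lemma mxnorm_le n (x : 'rV[R]_n) r : 0 <= r ->
  (`|x| <= r) <-> (forall i, `|x ord0 i| <= r).
Proof.
move=> r0; split => [xr i|H].
  apply: le_trans xr; rewrite [leRHS]mx_normrE.
  exact: (le_bigmax _ (fun i : 'I_1 * 'I_n => `|x i.1 i.2|) (ord0, i)).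
by rewrite [leLHS]mx_normrE; apply/bigmax_leP; split => // -[i j] _; rewrite (ord1 i); exact: H.
Qed.

Lemma measurable_fun_mxnorm n : measurable_fun setT (fun x : 'rV[R]_n => `|x| : R).
Proof.
apply: (@measurability _ _ _ _ _ _ (@measurable_realfun.RGenOpens.G R)).
  exact: measurable_realfun.RGenOpens.measurableE.
move=> _ [_ [a [b ->]] <-]; rewrite setTI; apply: open_measurable_rV.
apply: open_comp; last exact: interval_open.
by move=> x _; exact: norm_continuous.
Qed.

Lemma closed_measurable_rV n (A : set 'rV[R]_n) : closed A -> measurable A.
Proof.
by move=> cA; rewrite -(setCK A); apply: measurableC; apply: open_measurable_rV; exact: closed_openC.
Qed.

Lemma measurable_fun_rVB d (T : measurableType d) n (f g : T -> 'rV[R]_n) :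
  measurable_fun setT f -> measurable_fun setT g ->
  measurable_fun setT (fun t => f t - g t).
Proof.
move=> mf mg; apply: measurable_fun_rV => i.
rewrite (_ : (fun _ => _) = (fun t => f t ord0 i - g t ord0 i : R)).
  by apply: measurable_funB; exact: (measurableT_comp (measurable_coord i)).
by apply/funext => t; rewrite !mxE.
Qed.

Lemma measurable_fun_dist d (T : measurableType d) n (f g : T -> 'rV[R]_n) :
  measurable_fun setT f -> measurable_fun setT g ->
  measurable_fun setT (fun t => `|f t - g t| : R).
Proof.
move=> mf mg; apply: (measurableT_comp (@measurable_fun_mxnorm n)).
exact: measurable_fun_rVB.
Qed.

Definition shell n (x : 'rV[R]_n) (r s : R) : set 'rV[R]_n :=
  [set y | r < `|y - x| <= s].

Definition cball n (x : 'rV[R]_n) (r : R) : set 'rV[R]_n :=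
  [set y | `|y - x| <= r].

Lemma measurable_shell n (x : 'rV[R]_n) r s : measurable (shell x r s).
Proof.
rewrite (_ : shell x r s = (fun y => `|y - x| : R) @^-1` `]r, s]%classic).
  rewrite -[X in measurable X]setTI; apply: measurable_fun_dist => //.
by apply/seteqP; split => y; rewrite /shell /= in_itv.
Qed.

Lemma measurable_cball n (x : 'rV[R]_n) r : measurable (cball x r).
Proof.
rewrite (_ : cball x r = (fun y => `|y - x| : R) @^-1` `]-oo, r]%classic).
  rewrite -[X in measurable X]setTI; apply: measurable_fun_dist => //.
by apply/seteqP; split => y; rewrite /cball /= in_itv.
Qed.

Definition box n (a b : 'rV[R]_n) : set 'rV[R]_n :=
  [set x | forall i, x ord0 i \in `]a ord0 i, b ord0 i]].

Lemma measurable_box n (a b : 'rV[R]_n) : measurable (box a b).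
Proof.
rewrite (_ : box a b = \bigcap_(i in [set: 'I_n])
      (fun x : 'rV[R]_n => x ord0 i : R) @^-1` `]a ord0 i, b ord0 i]%classic).
  apply: fin_bigcap_measurable => // i _.
  by rewrite -[X in measurable X]setTI; apply: measurable_coord => //; exact: measurable_itv.
by apply/seteqP; split => [x /= H i _|x /= H i]; [exact: H|exact: (H i I)].
Qed.

Lemma measurable_cube n (N : R) : measurable (@cube R n N).
Proof.
rewrite (_ : cube N = \bigcap_(i in [set: 'I_n])
      (fun x : 'rV[R]_n => x ord0 i : R) @^-1` `[- N, N]%classic).
  apply: fin_bigcap_measurable => // i _.
  by rewrite -[X in measurable X]setTI; apply: measurable_coord => //; exact: measurable_itv.
by apply/seteqP; split => [x /= H i _|x /= H i]; [rewrite /= in_itv; exact: H|have := H i I; rewrite /= in_itv].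
Qed.

(** The constant 4 instead of 2 leaves room to enclose the closed ball in a
    half-open box, whose volume is known. *)
Lemma lebesgue_cball_le n (x : 'rV[R]_n) r : 0 < r ->
  (lebesgue_rV R n (cball x r) <= ((4 * r) ^+ n)%:E)%E.
Proof.
move=> r0.
have -> : (4 * r) ^+ n = \prod_(i < n)
    ((x + const_mx (2 * r)) ord0 i - (x - const_mx (2 * r)) ord0 i).
  under eq_bigr do rewrite !mxE.
  rewrite (eq_bigr (fun=> 4 * r)); first by rewrite big_const_ord iter_mulr_1.
  by move=> i _; ring.
rewrite -lebesgue_rV_box; last by move=> i; rewrite !mxE; lra.
apply: le_measure; rewrite ?inE; first exact: measurable_cball.
  exact: measurable_box.
move=> y /(mxnorm_le _ (ltW r0)) yx i; have := yx i; rewrite !mxE.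
by rewrite ler_norml in_itv/= => /andP[]; lra.
Qed.

(** In each coordinate the interval of length [r] that starts at [z] and points
    towards the origin stays between [- N] and [N]. *)
Lemma lebesgue_cube_cball_ge n (N : R) (z : 'rV[R]_n) r : 0 < r -> r <= N ->
  cube N z -> ((r ^+ n)%:E <= lebesgue_rV R n (cube N `&` cball z r))%E.
Proof.
move=> r0 rN zN.
pose a : 'rV[R]_n := \row_i (if z ord0 i <= 0 then z ord0 i else z ord0 i - r).
have aE i : (a + const_mx r) ord0 i = a ord0 i + r by rewrite !mxE.
have -> : r ^+ n = \prod_(i < n) ((a + const_mx r) ord0 i - a ord0 i).
  rewrite (eq_bigr (fun=> r)); last by move=> i _; rewrite aE; ring.
  by rewrite big_const_ord iter_mulr_1.
rewrite -lebesgue_rV_box; last by move=> i; rewrite aE lerDl ltW.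
apply: le_measure; rewrite ?inE; first exact: measurable_box.
  by apply: measurableI; [exact: measurable_cube|exact: measurable_cball].
move=> y yb; split => [i|].
  by have := yb i; have := zN i; rewrite !mxE in_itv/=; case: ifP; lra.
apply/(mxnorm_le _ (ltW r0)) => i; have := yb i; have := zN i.
by rewrite ler_norml !mxE in_itv/=; case: ifP; lra.
Qed.

Lemma lebesgue_set1 n (x : 'rV[R]_n) : (0 < n)%N -> lebesgue_rV R n [set x] = 0%E.
Proof.
move=> n0; apply/eqP; rewrite eq_le measure_ge0 andbT.
apply/lee_addgt0Pr => e e0; rewrite add0e.
pose r := Num.min 1 e / 4.
have r0 : 0 < r by rewrite divr_gt0// lt_min ltr01.
have m1 : measurable [set x].
  by apply: closed_measurable_rV; apply: accessible_closed_set1; apply: hausdorff_accessible; exact: norm_hausdorff.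
apply: (@le_trans _ _ (lebesgue_rV R n (cball x r))).
  apply: le_measure; rewrite ?inE//; first exact: measurable_cball.
  by move=> _ ->; rewrite /cball/= subrr normr0 ltW.
apply: le_trans (lebesgue_cball_le x r0) _; rewrite lee_fin /r mulrCA divff// mulr1.
case: n n0 {x r r0 m1} => // n _.
rewrite exprS; apply: (@le_trans _ _ (Num.min 1 e)); last by rewrite ge_min lexx orbT.
by rewrite ler_piMr ?exprn_ile1 ?le_min ?ler01 ?(ltW e0)// ge_min lexx.
Qed.

(** The value at 0 makes pointwise upper bounds hold on the diagonal as well; as
    points are Lebesgue null in positive dimension this does not change
    integrals. *)
Definition rpow (a r : R) : \bar R :=
  if r == 0 then +oo%E else (r `^ (- a))%:E.


Lemma rpow_ge0 a r : (0 <= rpow a r)%E.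
Proof. by rewrite /rpow; case: ifP => // _; rewrite lee_fin powR_ge0. Qed.

Lemma rpowE a r : r != 0 -> rpow a r = (r `^ (- a))%:E.
Proof. by rewrite /rpow => /negPf ->. Qed.

Lemma rpow_le a r s : 0 <= a -> 0 < r -> r <= s -> (rpow a s <= (r `^ (- a))%:E)%E.
Proof.
move=> a0 r0 rs; rewrite rpowE ?gt_eqF ?(lt_le_trans r0)// lee_fin !powRN.
rewrite lef_pV2 ?posrE ?powR_gt0 ?(lt_le_trans r0)//.
by rewrite ge0_ler_powR// nnegrE ltW// (lt_le_trans r0).
Qed.

Lemma measurable_rpow a : measurable_fun setT (rpow a).
Proof.
apply: measurable_fun_ifT => //.
  exact: measurable_fun_eqr.
by apply/measurable_EFinP; exact: measurable_powR.
Qed.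

Lemma measurable_rpow_dist d (T : measurableType d) n a (f g : T -> 'rV[R]_n) :
  measurable_fun setT f -> measurable_fun setT g ->
  measurable_fun setT (fun t => rpow a `|f t - g t|).
Proof.
by move=> mf mg; apply: (measurableT_comp (measurable_rpow a)); exact: measurable_fun_dist.
Qed.

Lemma rpow_shell n (a : R) (x : 'rV[R]_n) (r : R) : 0 <= a -> 0 < r ->
  (\int[lebesgue_rV R n]_(y in shell x r (2 * r)) rpow a `|y - x|%R <=
   (8 ^+ n * r `^ (n%:R - a))%:E)%E.
Proof.
move=> a0 r0.
apply: (@le_trans _ _ (\int[lebesgue_rV R n]_(y in shell x r (2 * r)) (r `^ (- a))%:E)%E).
  apply: ge0_integral_mono => y; first by rewrite rpow_ge0.
  by rewrite /shell/= => /andP[ry _]; apply: rpow_le => //; exact: ltW.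
rewrite integral_cst; last exact: measurable_shell.
apply: (@le_trans _ _ ((r `^ (- a))%:E * ((4 * (2 * r)) ^+ n)%:E)%E).
  rewrite lee_wpmul2l// ?lee_fin ?powR_ge0//.
  apply: (@le_trans _ _ (lebesgue_rV R n (cball x (2 * r)))).
    apply: le_measure; rewrite ?inE; first exact: measurable_shell.
      exact: measurable_cball.
    by move=> y /andP[].
  by apply: lebesgue_cball_le; rewrite mulr_gt0.
rewrite -EFinM lee_fin mulrA exprMn (_ : 4 * 2 = 8 :> R); last by ring.
rewrite powRD ?(gt_eqF r0) ?implybT// powR_mulrn ?(ltW r0)//.
by rewrite mulrCA [X in _ * X]mulrC.
Qed.

Lemma rpow_shellD n a (x : 'rV[R]_n) r s t : r <= s -> s <= t ->
  (\int[lebesgue_rV R n]_(y in shell x r t) rpow a `|y - x|%R =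
   \int[lebesgue_rV R n]_(y in shell x r s) rpow a `|y - x|%R +
   \int[lebesgue_rV R n]_(y in shell x s t) rpow a `|y - x|%R)%E.
Proof.
move=> rs st.
have -> : shell x r t = shell x r s `|` shell x s t.
  apply/seteqP; split => y; rewrite /shell/=.
    by move=> /andP[ry yt]; case: (leP `|y - x| s) => ys; [left|right]; rewrite ?ry ?yt.
  move=> [/andP[ry ys]|/andP[sy yt]]; apply/andP; split => //.
    exact: le_trans ys st.
  exact: le_lt_trans rs sy.
rewrite ge0_integral_setU//.
- exact: measurable_shell.
- exact: measurable_shell.
- by apply: measurable_funTS; apply: measurable_rpow_dist.
- by move=> y _; exact: rpow_ge0.
- apply/disj_set2P/seteqP; split => // y [] /andP[_ ys] /andP[sy _].
  by move: (lt_le_trans sy ys); rewrite ltxx.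
Qed.

Lemma powR_exprn (x a : R) K : 0 <= x -> (x ^+ K) `^ a = (x `^ a) ^+ K.
Proof.
by move=> x0; rewrite -powR_mulrn// -powRrM mulrC powRrM powR_mulrn// powR_ge0.
Qed.

Lemma powR_invr (x a : R) : 0 <= x -> x^-1 `^ a = x `^ (- a).
Proof. by move=> x0; rewrite -powR_inv1// -powRrM mulN1r. Qed.

Lemma powR2_lt1 (a : R) : a < 0 -> 2 `^ a < 1.
Proof.
move=> a0; rewrite /powR pnatr_eq0/= expR_lt1 nmulr_rlt0//.
by rewrite ln_gt0// ltr1n.
Qed.

(** For [a > n] the dyadic shells contribute a geometric series dominated by the
    innermost one, whence a bound that does not depend on the number of shells.
    The factor [1 - q ^+ K] carried along the induction is the partial sum. *)
Lemma rpow_shell_up n a (x : 'rV[R]_n) r K : n%:R < a -> 0 < r ->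
  (\int[lebesgue_rV R n]_(y in shell x r (2 ^+ K * r)) rpow a `|y - x|%R <=
   (8 ^+ n / (1 - 2 `^ (n%:R - a)) * r `^ (n%:R - a))%:E)%E.
Proof.
move=> na r0; set q := 2 `^ (n%:R - a).
have q1 : q < 1.
  by apply: powR2_lt1; rewrite subr_lt0.
have q0 : 0 <= q by rewrite powR_ge0.
have a0 : 0 <= a by rewrite (le_trans _ (ltW na)).
apply: (@le_trans _ _ (8 ^+ n / (1 - q) * r `^ (n%:R - a) * (1 - q ^+ K))%:E); last first.
  rewrite lee_fin ler_piMr//; last by rewrite gerBl exprn_ge0.
  by rewrite !mulr_ge0 ?powR_ge0 ?invr_ge0 ?exprn_ge0 ?subr_ge0 ?(ltW q1).
elim: K => [|K IH].
  rewrite expr0 mul1r subrr mulr0 (_ : shell _ _ _ = set0) ?integral_set0//.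
  apply/seteqP; split => // y /andP[ry yr].
  by move: (lt_le_trans ry yr); rewrite ltxx.
have K2 : 0 < 2 ^+ K * r by rewrite mulr_gt0// exprn_gt0.
rewrite (@rpow_shellD _ _ _ _ (2 ^+ K * r)); last 2 first.
  by rewrite ler_peMl ?exprn_ege1 ?ler1n// ltW.
  by rewrite exprS -mulrA ler_peMl ?ler1n// ltW.
rewrite exprS -mulrA; apply: le_trans (leeD IH (rpow_shell _ a0 K2)) _.
rewrite -EFinD lee_fin powRM ?(ltW r0) ?exprn_ge0//.
rewrite (powR_exprn _ _ (ler0n R 2)) -/q.
rewrite le_eqVlt; apply/orP; left; apply/eqP; rewrite exprS; field.
by rewrite subr_eq0 gt_eqF.
Qed.

Lemma rpow_shell_critical n (x : 'rV[R]_n) r K : 0 < r ->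
  (\int[lebesgue_rV R n]_(y in shell x r (2 ^+ K * r)) rpow n%:R `|y - x|%R <=
   (8 ^+ n * K%:R)%:E)%E.
Proof.
move=> r0.
elim: K => [|K IH].
  rewrite expr0 mul1r mulr0 (_ : shell _ _ _ = set0) ?integral_set0//.
  apply/seteqP; split => // y /andP[ry yr].
  by move: (lt_le_trans ry yr); rewrite ltxx.
have K2 : 0 < 2 ^+ K * r by rewrite mulr_gt0// exprn_gt0.
rewrite (@rpow_shellD _ _ _ _ (2 ^+ K * r)); last 2 first.
  by rewrite ler_peMl ?exprn_ege1 ?ler1n// ltW.
  by rewrite exprS -mulrA ler_peMl ?ler1n// ltW.
rewrite exprS -mulrA; apply: le_trans (leeD IH (rpow_shell _ _ K2)) _ => //.
by rewrite -EFinD lee_fin subrr powRr0 mulr1 -(natr1 K) mulrDr mulr1.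
Qed.

(** For [a < n] the same geometric series runs inwards and converges: the ball
    minus its centre is the increasing union of the shells [F K]. *)
Lemma rpow_cball n a (x : 'rV[R]_n) r : (0 < n)%N -> 0 <= a -> a < n%:R -> 0 < r ->
  (\int[lebesgue_rV R n]_(y in cball x r) rpow a `|y - x|%R <=
   (8 ^+ n / (1 - 2 `^ (a - n%:R)) * r `^ (n%:R - a))%:E)%E.
Proof.
move=> n0 a0 an r0; set q := 2 `^ (a - n%:R).
have q1 : q < 1.
  by apply: powR2_lt1; rewrite subr_lt0.
have q0 : 0 <= q by rewrite powR_ge0.
pose F K := shell x (2 ^- K * r) r.
have U : cball x r `\` [set x] = \bigcup_K F K.
  apply/seteqP; split => y.
    move=> [yr /eqP yx]; have : 0 < `|y - x| by rewrite normr_gt0 subr_eq0.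
    move=> d0; pose K := Num.truncn (r / `|y - x|); exists K => //.
    rewrite /F/shell/= yr andbT mulrC ltr_pdivrMr ?exprn_gt0//.
    rewrite -ltr_pdivrMl// mulrC.
    have /andP[_] := truncn_itv (divr_ge0 (ltW r0) (ltW d0)).
    move=> /lt_le_trans; apply; rewrite -natrX ler_nat.
    exact: ltn_expl.
  move=> [K _ /andP[Ky yr]]; split => // yx; move: Ky; rewrite yx subrr normr0.
  by rewrite ltNge mulr_ge0 ?invr_ge0 ?exprn_ge0// ltW.
have mr : measurable_fun setT (fun y : 'rV[R]_n => rpow a `|y - x|) by exact: measurable_rpow_dist.
have m1 : measurable [set x].
  by apply: closed_measurable_rV; apply: accessible_closed_set1; apply: hausdorff_accessible; exact: norm_hausdorff.
rewrite (ge0_negligible_integral m1 (@measurable_cball _ x r) (measurable_funTS mr) _ (lebesgue_set1 x n0)); last first.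
  by move=> y _; exact: rpow_ge0.
rewrite U.
have FK K : (\int[lebesgue_rV R n]_(y in F K) rpow a `|y - x|%R <=
   (8 ^+ n / (1 - q) * r `^ (n%:R - a))%:E)%E.
  apply: (@le_trans _ _ (8 ^+ n / (1 - q) * r `^ (n%:R - a) * (1 - q ^+ K))%:E); last first.
    rewrite lee_fin ler_piMr//; last by rewrite gerBl exprn_ge0.
    by rewrite !mulr_ge0 ?powR_ge0 ?invr_ge0 ?exprn_ge0 ?subr_ge0 ?(ltW q1).
  elim: K => [|K IH].
    rewrite /F expr0 invr1 mul1r subrr mulr0 (_ : shell _ _ _ = set0) ?integral_set0//.
    apply/seteqP; split => // y /andP[ry yr].
    by move: (lt_le_trans ry yr); rewrite ltxx.
  have K2 : 0 < 2 ^- K.+1 * r by rewrite mulr_gt0// invr_gt0 exprn_gt0.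
  have K1 : 2 ^- K * r = 2 * (2 ^- K.+1 * r).
    by rewrite mulrA exprS invfM mulrA divff// mul1r.
  rewrite /F (@rpow_shellD _ _ _ _ (2 ^- K * r)); last 2 first.
    by rewrite K1 ler_peMl ?ler1n// ltW.
    by rewrite ler_piMl ?invf_le1 ?exprn_gt0 ?exprn_ege1 ?ler1n// ltW.
  rewrite addeC; apply: le_trans (leeD IH _) _.
    by rewrite K1; exact: (rpow_shell _ a0 K2).
  rewrite -EFinD lee_fin powRM ?(ltW r0) ?invr_ge0 ?exprn_ge0//.
  rewrite powR_invr ?exprn_ge0 ?ler0n// opprB (powR_exprn _ _ (ler0n R 2)) -/q.
  have e0 : 0 <= 8 ^+ n * r `^ (n%:R - a) * q ^+ K.
    by rewrite !mulr_ge0 ?powR_ge0 ?exprn_ge0.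
  rewrite -subr_ge0 (_ : _ - _ = (8 ^+ n * r `^ (n%:R - a) * q ^+ K) * (1 - q)).
    by rewrite mulr_ge0// subr_ge0 ltW.
  by rewrite exprS; field; rewrite subr_eq0 gt_eqF.
have := @ge0_nondecreasing_set_cvg_integral _ _ _ F (fun y : 'rV[R]_n => rpow a `|y - x|) (lebesgue_rV R n).
have ndF : nondecreasing_seq F.
  apply/nondecreasing_seqP => K; apply/subsetPset => y /andP[Ky yr]; apply/andP; split => //.
  apply: le_lt_trans Ky; rewrite ler_pM2r// lef_pV2 ?posrE ?exprn_gt0//.
  by rewrite exprS ler_peMl ?ler1n// exprn_ge0.
move=> /(_ ndF (fun K => measurable_shell _ _ _) (fun K => measurable_funTS mr) (fun K y _ => rpow_ge0 _ _)) /cvg_lim <-//.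
apply: lime_le; last by apply: nearW => K; exact: FK.
apply: ereal_nondecreasing_is_cvgn.
apply: ge0_nondecreasing_set_nondecreasing_integral.
- exact: ndF.
- by move=> K; exact: measurable_shell.
- by move=> K; exact: measurable_funTS.
- by move=> K y _; exact: rpow_ge0.
Qed.

End euclidean_space.

(** * Borel probability measures and continuous processes *)

Section borel_measures.
Context {R : realType}.

Lemma le_measure_bigcap d (T : measurableType d) (P : {finite_measure set T -> \bar R})
  (E : (set T)^nat) (a : \bar R) :
  nonincreasing_seq E -> (forall n, measurable (E n)) ->
  (forall n, a <= P (E n))%E -> (a <= P (\bigcap_n E n))%E.
Proof.
move=> niE mE aE.
have mI : measurable (\bigcap_n E n) by exact: bigcapT_measurable.
have finE : (P (E 0%N) < +oo)%E.
  by rewrite -ge0_fin_numE//; exact: fin_num_measure.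
have c := nonincreasing_cvg_mu finE mE mI niE.
rewrite -(cvg_lim _ c)//; apply: lime_ge; first by apply/cvg_ex; eexists; exact: c.
by apply: nearW => n; exact: aE.
Qed.

Definition closed_open_approx n (mu : {finite_measure set 'rV[R]_n -> \bar R}) (A : set 'rV[R]_n) :=
  forall e : R, 0 < e -> exists C U, [/\ closed C, open U, C `<=` A, A `<=` U &
    (mu (U `\` C) <= e%:E)%E].

(** [C k] consists of the points at distance at least [1 / (k + 1)] from the
    complement, written as the complement of a union of balls. *)
Lemma closed_exhaustion n (U : set 'rV[R]_n) : open U ->
  exists C : (set 'rV[R]_n)^nat, [/\ forall k, closed (C k), nondecreasing_seq C &
    \bigcup_k C k = U].
Proof.
move=> oU.
pose C (k : nat) := ~` \bigcup_(y in ~` U) ball y (k.+1%:R^-1 : R).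
exists C; split.
- move=> k; apply: open_closedC; apply: bigcup_open => y _; exact: ball_open.
- apply/nondecreasing_seqP => k; apply/subsetPset; apply: subsetC.
  apply: subset_bigcup => y _; apply: le_ball.
  by rewrite lef_pV2 ?posrE// ler_nat.
apply/seteqP; split => x.
  move=> [k _ Cx]; apply: contrapT => Ux; apply: Cx; exists x => //.
  by apply: ballxx.
move=> Ux; have /nbhs_ballP[e /= e0 eU] : nbhs x U by exact: open_nbhs_nbhs.
exists (Num.truncn e^-1) => // -[y Uy yx]; apply: Uy; apply: eU.
apply: ball_sym; apply: le_ball yx; rewrite invf_ple ?posrE//.
have ie0 : 0 <= e^-1 by rewrite invr_ge0 ltW.
by have /andP[_ /ltW] := truncn_itv ie0.
Qed.

(** The sets that are squeezed between a closed and an open set up to arbitrarily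
    small mass form a sigma-algebra; it contains the open sets because they are
    countable unions of closed sets. *)
Lemma borel_approx n (mu : {finite_measure set 'rV[R]_n -> \bar R}) (A : set 'rV[R]_n) :
  measurable A -> closed_open_approx mu A.
Proof.
have cvg0 (C : (set 'rV[R]_n)^nat) (e : R) : 0 < e -> (forall k, measurable (C k)) ->
    nondecreasing_seq C -> exists k, (mu ((\bigcup_i C i) `\` C k) <= e%:E)%E.
  move=> e0 mC ndC.
  have mU : measurable (\bigcup_i C i) by exact: bigcupT_measurable.
  have h : mu \o (fun k => (\bigcup_i C i) `\` C k) @ \oo --> (0 : \bar R)%E.
    rewrite -(measure0 mu) (_ : set0 = \bigcap_k ((\bigcup_i C i) `\` C k)).
      apply: nonincreasing_cvg_mu.
      - by rewrite -ge0_fin_numE//; apply: fin_num_measure; exact: measurableD.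
      - by move=> k; exact: measurableD.
      - by apply: bigcapT_measurable => k; exact: measurableD.
      - move=> i j ij; apply/subsetPset; apply: setDS; apply/subsetPset; exact: ndC.
    apply/esym/seteqP; split => // x H.
    by have [[k _ Ck] _] := H 0%N I; have [_] := H k I.
  have e0' : ((0 : \bar R) < e%:E)%E by rewrite lte_fin.
  have [k _ /(_ k (leqnn k))] := h _ (open_ereal_lt' e0').
  by move=> /ltW; exists k.
suff H : sigma_algebra setT (closed_open_approx mu).
  by apply: (smallest_sub H) => U oU e e0;
  have [C [cC ndC CU]] := closed_exhaustion oU;
  have [k Hk] := cvg0 C e e0 (fun k => closed_measurable_rV (cC k)) ndC;
  exists (C k), U; split => //; rewrite -?CU//; exact: bigcup_sup.
split.
- move=> e e0; exists set0, set0; split => //; first exact: closed0.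
  by rewrite setD0 measure0 lee_fin ltW.
- move=> B HB e e0; have [C [U [cC oU CB BU UC]]] := HB e e0.
  exists (~` U), (~` C); rewrite setTD; split.
  + exact: open_closedC.
  + exact: closed_openC.
  + exact: subsetC.
  + exact: subsetC.
  + by rewrite setDE setCK setIC -setDE.
move=> F HF e e0.
pose e_ k : R := e / 2 / (2 ^ k.+1)%:R.
have e_0 k : 0 < e_ k by rewrite !divr_gt0// ltr0n expn_gt0.
have /choice[CU hCU] : forall k, exists CU : set 'rV[R]_n * set 'rV[R]_n,
    [/\ closed CU.1, open CU.2, CU.1 `<=` F k, F k `<=` CU.2 & (mu (CU.2 `\` CU.1) <= (e_ k)%:E)%E].
  by move=> k; have [C [U H]] := HF k _ (e_0 k); exists (C, U).
pose C k := (CU k).1; pose U k := (CU k).2.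
have cC k : closed (C k) by have [] := hCU k.
have oU k : open (U k) by have [] := hCU k.
pose D k := \bigcup_(i < k) C i.
have cD k : closed (D k).
  rewrite /D bigcup_mkord; elim: k => [|k IH]; first by rewrite big_ord0; exact: closed0.
  by rewrite big_ord_recr/=; exact: closedU.
have ndD : nondecreasing_seq D.
  by apply/nondecreasing_seqP => k; apply/subsetPset => x [i /= ik Ci]; exists i => //=; rewrite ltnS ltnW.
have DC : \bigcup_k D k = \bigcup_k C k.
  apply/seteqP; split => x; first by move=> [k _ [i _ Ci]]; exists i.
  by move=> [k _ Ck]; exists k.+1 => //; exists k => /=.
have e20 : 0 < e / 2 by rewrite divr_gt0.
have [k Hk] := cvg0 D _ e20 (fun k => closed_measurable_rV (cD k)) ndD.
exists (D k), (\bigcup_i U i); split.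
- exact: cD.
- by apply: bigcup_open => i _; exact: oU.
- by move=> x [i _ Ci]; exists i => //; have [_ _ + _ _] := hCU i; apply.
- by move=> x [i _ Fi]; exists i => //; have [_ _ _ + _] := hCU i; apply.
have mUC i : measurable (U i `\` C i).
  by apply: measurableD; [exact: open_measurable_rV|exact: closed_measurable_rV].
have mD0 : measurable (\bigcup_i D i `\` D k).
  apply: measurableD; last exact: closed_measurable_rV.
  by apply: bigcupT_measurable => i; exact: closed_measurable_rV.
have mUCs : measurable (\bigcup_i (U i `\` C i)) by exact: bigcupT_measurable.
apply: (@le_trans _ _ (mu ((\bigcup_i D i `\` D k) `|` \bigcup_i (U i `\` C i)))).
  apply: le_measure; rewrite ?inE.
  - apply: measurableD; last exact: closed_measurable_rV.
    by apply: bigcupT_measurable => i; exact: open_measurable_rV.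
  - exact: measurableU.
  - move=> x [[i _ Ui] nD]; have [Cx|Cx] := pselect ((\bigcup_j C j) x).
      by left; split => //; rewrite DC.
    by right; exists i => //; split => // Ci; apply: Cx; exists i.
apply: le_trans (measureU2 _ _ _) _ => //.
rewrite [e]splitr EFinD; apply: leeD => //.
apply: (@le_trans _ _ (\sum_(0 <= i <oo) mu (U i `\` C i))%E).
  exact: measure_sigma_subadditive.
apply: le_trans (epsilon_trick0 xpredT (ltW e20)).
by apply: lee_nneseries => // i _; have [_ _ _ _] := hCU i.
Qed.

Lemma compact_cube n (N : R) : compact (@cube R n N).
Proof.
rewrite (_ : cube N = [set z : 'rV[R]_n | forall i, `[- N, N]%classic (z ord0 i)]).
  by apply: (@rV_compact R n (fun=> `[- N, N]%classic)) => i; exact: segment_compact.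
by apply/seteqP; split => z zN i; have := zN i; rewrite /= in_itv.
Qed.

(** Capacity is inner regular through this lemma: hitting a compact subset of
    [A] that carries half of the mass is enough, and compactness turns
    approximate hits into exact ones. *)
Lemma compact_approx n (mu : {finite_measure set 'rV[R]_n -> \bar R}) (A : set 'rV[R]_n)
  (N e : R) : measurable A -> A `<=` cube N -> 0 < e ->
  exists F, [/\ compact F, F `<=` A & (mu A <= mu F + e%:E)%E].
Proof.
move=> mA AN e0; have [C [U [cC oU CA AU UC]]] := borel_approx mu mA e0.
exists C; split => //.
  by apply: subclosed_compact (@compact_cube n N) _ => //; exact: subset_trans AN.
have mC := closed_measurable_rV cC.
apply: (@le_trans _ _ (mu (C `|` (U `\` C)))).
  apply: le_measure; rewrite ?inE//.
    by apply: measurableU => //; apply: measurableD => //; exact: open_measurable_rV.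
  by move=> x Ax; have [Cx|Cx] := pselect (C x); [left|right; split => //; exact: AU].
apply: le_trans (measureU2 _ _ _) _ => //.
  by apply: measurableD => //; exact: open_measurable_rV.
exact: leeD.
Qed.

(** Rounding the parameter down to the grid of mesh [1 / (k + 1)] gives a process
    with countably many parameters, which is jointly measurable; continuity lets
    the mesh tend to 0. *)
Lemma measurable_fun_joint d (T : measurableType d) m n (f : 'rV[R]_m -> T -> 'rV[R]_n) :
  (forall x, measurable_fun setT (f x)) -> (forall w, continuous (fun x => f x w)) ->
  measurable_fun setT (fun p : 'rV[R]_m * T => f p.1 p.2).
Proof.
move=> mf cf; apply: measurable_fun_rV => j.
pose flo (k : nat) (x : 'rV[R]_m) : 'rV[int]_m := \row_i Num.floor (k.+1%:R * x ord0 i).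
pose pt (k : nat) (q : 'rV[int]_m) : 'rV[R]_m := \row_i ((q ord0 i)%:~R / k.+1%:R).
pose h (k : nat) (p : 'rV[R]_m * T) : R := f (pt k (flo k p.1)) p.2 ord0 j.
apply: (@measurable_fun_cvg _ _ _ _ h) => //.
  move=> k _ B mB; rewrite setTI.
  rewrite (_ : _ @^-1` B = \bigcup_(q in [set: 'rV[int]_m])
    ((flo k @^-1` [set q]) `*` ((fun w => f (pt k q) w ord0 j) @^-1` B))); last first.
    apply/seteqP; split => [[x w] H|[x w] [q _ [/= <-]]]//.
    by exists (flo k x).
  apply: countable_bigcupT_measurable; first exact: countableP.
  move=> q; apply: measurableX; last first.
    rewrite -[X in measurable X]setTI.
    exact: (measurableT_comp (measurable_coord j) (mf _)).
  rewrite (_ : _ @^-1` _ = \bigcap_(i in [set: 'I_m])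
      (fun x : 'rV[R]_m => x ord0 i : R) @^-1`
         `[(q ord0 i)%:~R / k.+1%:R, (q ord0 i + 1)%:~R / k.+1%:R[%classic).
    apply: fin_bigcap_measurable => // i _.
    by rewrite -[X in measurable X]setTI; apply: measurable_coord => //; exact: measurable_itv.
  have E (x : 'rV[R]_m) i :
      `[(q ord0 i)%:~R / k.+1%:R, (q ord0 i + 1)%:~R / k.+1%:R[%classic (x ord0 i) <->
      Num.floor (k.+1%:R * x ord0 i) = q ord0 i.
    rewrite /= in_itv/= ler_pdivrMr// ltr_pdivlMr// mulrC -floor_eq.
    by split => /eqP.
  apply/seteqP; split => x.
    by move=> xq i _; apply/E; rewrite -xq mxE.
  by move=> H; apply/rowP => i; rewrite mxE; apply/E; exact: (H i I).
move=> [x w] _ /=.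
have cfj : continuous (fun x => f x w ord0 j : R).
  move=> y; apply: (@continuous_comp _ _ _ (fun x => f x w) (fun u : 'rV[R]_n => u ord0 j : R)).
    exact: cf.
  exact: coord_continuous.
suff pcvg : pt k (flo k x) @[k --> \oo] --> x by exact: (cvg_comp _ _ pcvg (cfj x)).
apply/cvgrPdist_le => e e0.
near=> k.
apply/mxnorm_le; first exact: ltW.
move=> i; rewrite !mxE.
have k0 : 0 < k.+1%:R :> R by [].
have k1 : k.+1%:R^-1 <= e.
  rewrite invf_ple ?posrE//.
  apply: (@le_trans _ _ k%:R); last by rewrite ler_nat.
  by near: k; exact: nbhs_infty_ger.
apply: le_trans k1.
have /andP[h1 h2] := floor_itv (k.+1%:R * x ord0 i).
move: (Num.floor _) h1 h2 => fl h1 h2.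
have -> : x ord0 i - fl%:~R / k.+1%:R = (k.+1%:R * x ord0 i - fl%:~R) / k.+1%:R.
  by rewrite mulrBl mulrAC divff ?mul1r// gt_eqF.
rewrite normrM [`|_^-1|]gtr0_norm ?invr_gt0// ger0_norm ?subr_ge0//.
by rewrite ler_piMl ?invr_ge0// lerBlDl ltW// -intrD1.
Unshelve. all: by end_near. Qed.

(** Upper semicontinuity of [x |-> P (f x \in C)] for closed [C]: if [y k] tends to
    [x] and [f (y k) w] is in [C] for infinitely many [k], then [f x w] is in [C].
    Closedness survives arbitrary intersections, which is how measurability in
    time is obtained below without countability. *)
Lemma closed_prob_ge d (T : measurableType d) (P : {finite_measure set T -> \bar R})
  m n (f : 'rV[R]_m -> T -> 'rV[R]_n) (C : set 'rV[R]_n) (a : \bar R) :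
  (forall x, measurable_fun setT (f x)) -> (forall w, continuous (fun x => f x w)) ->
  closed C -> closed [set x | (a <= P (f x @^-1` C))%E].
Proof.
move=> mf cf cC x xS.
have /choice[y hy] : forall k : nat, exists y, (a <= P (f y @^-1` C))%E /\ ball x (k.+1%:R^-1) y.
  move=> k; have k0 : 0 < k.+1%:R^-1 :> R by rewrite invr_gt0.
  have [y [yS xy]] := xS _ (nbhsx_ballx x _ k0).
  by exists y.
have mfC k : measurable (f (y k) @^-1` C).
  by rewrite -[X in measurable X]setTI; apply: mf => //; exact: closed_measurable_rV.
pose E n := \bigcup_(k in [set k | (n <= k)%N]) f (y k) @^-1` C.
have mE k : measurable (E k) by apply: bigcup_measurable.
have mx : measurable (f x @^-1` C).
  by rewrite -[X in measurable X]setTI; apply: mf => //; exact: closed_measurable_rV.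
have ycvg : y k @[k --> \oo] --> x.
  apply/cvg_ballP => e e0; near=> k; have [_ +] := hy k; apply: le_ball.
  rewrite invf_ple ?posrE//; apply: (@le_trans _ _ k%:R); last by rewrite ler_nat.
  by near: k; exact: nbhs_infty_ger.
apply: (@le_trans _ _ (P (\bigcap_k E k))).
  apply: le_measure_bigcap => //.
    apply/nonincreasing_seqP => k; apply/subsetPset => w [i /= ki Ci].
    by exists i => //=; exact: ltnW.
  move=> k; have [ak _] := hy k; apply: le_trans ak _.
  by apply: le_measure; rewrite ?inE// => w Cw; exists k => /=.
apply: le_measure; rewrite ?inE//; first exact: bigcapT_measurable.
move=> w Ew /=.
have fcvg := cvg_comp _ _ ycvg (cf w x).
apply: contrapT => nC.
have : nbhs (f x w) (~` C) by apply: open_nbhs_nbhs; split => //; exact: closed_openC.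
move=> /fcvg[k _ kC]; have [i /= ki Ci] := Ew k I.
exact: (kC i ki).
Unshelve. all: by end_near. Qed.

End borel_measures.

(** * Kernels, and infinite energy in high order *)

Section kernels.
Context {R : realType}.

Lemma enorm_ge0 n (x : 'rV[R]_n) : 0 <= enorm x.
Proof. exact: sqrtr_ge0. Qed.

Lemma mxnorm_le_enorm n (x : 'rV[R]_n) : `|x| <= enorm x.
Proof.
apply/mxnorm_le; first exact: enorm_ge0.
move=> i; rewrite -sqrtr_sqr ler_wsqrtr// (bigD1 i)//= lerDl.
by apply: sumr_ge0 => j _; exact: sqr_ge0.
Qed.

Lemma enorm_le_mxnorm n (x : 'rV[R]_n) : enorm x <= Num.sqrt n%:R * `|x|.
Proof.
have h : `|x| = Num.sqrt (`|x| ^+ 2) by rewrite sqrtr_sqr ger0_norm.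
rewrite /enorm h -sqrtrM ?ler0n// ler_wsqrtr//.
apply: (@le_trans _ _ (\sum_(i < n) `|x| ^+ 2)).
  apply: ler_sum => i _; rewrite -[leLHS]real_normK ?num_real//.
  by rewrite lerXn2r ?nnegrE//; move: i; apply/mxnorm_le.
by rewrite big_const_ord iter_addr_0 mulr_natl.
Qed.

Lemma enorm0 n : enorm (0 : 'rV[R]_n) = 0.
Proof.
apply/eqP; rewrite eq_le enorm_ge0 andbT.
by apply: le_trans (enorm_le_mxnorm _) _; rewrite normr0 mulr0.
Qed.

Lemma enorm_eq0 n (x : 'rV[R]_n) : (enorm x == 0) = (x == 0).
Proof.
apply/eqP/eqP => [x0|->]; last exact: enorm0.
by apply/eqP; rewrite -normr_le0 -x0; exact: mxnorm_le_enorm.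
Qed.

Lemma measurable_enorm n : measurable_fun setT (@enorm R n).
Proof.
apply: (measurableT_comp (continuous_measurable_fun (@sqrt_continuous R))).
by apply: measurable_sum => i; apply: measurable_funX; exact: measurable_coord.
Qed.

Lemma cube_dist n (N : R) (x y : 'rV[R]_n) : 0 <= N -> cube N x -> cube N y ->
  `|x - y| <= 2 * N.
Proof.
move=> N0 xN yN; apply/mxnorm_le; first by rewrite mulr_ge0.
by move=> i; rewrite !mxE ler_norml; have := xN i; have := yN i; lra.
Qed.

Lemma cube_edist n (N : R) (x y : 'rV[R]_n) : 0 <= N -> cube N x -> cube N y ->
  enorm (x - y) <= 2 * N * Num.sqrt n%:R.
Proof.
move=> N0 xN yN; apply: le_trans (enorm_le_mxnorm _) _.
by rewrite mulrC ler_wpM2r ?sqrtr_ge0//; exact: cube_dist.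
Qed.

Lemma measurable_bessel_riesz cstar b :
  measurable_fun setT (fun r : R => bessel_riesz_kernel cstar b `|r|).
Proof.
pose k (r : R) := if b < 0 then 1%E
  else if r == 0 then +oo%E else if b == 0 then (ln (cstar * r `^ (- 1)))%:E
  else (r `^ (- b))%:E.
rewrite (_ : (fun _ => _) = k \o (@Num.norm R R)); last first.
  by apply/funext => r; rewrite /= /k powR_inv1.
have mk : measurable_fun setT k.
  rewrite /k; case: (b < 0) => //.
  apply: measurable_fun_ifT => //; first exact: measurable_fun_eqr.
  case: (b == 0); last by apply/measurable_EFinP; exact: measurable_powR.
  apply/measurable_EFinP; apply: (measurableT_comp (@measurable_ln R)).
  by apply: measurable_funM => //; exact: measurable_powR.
exact: (measurableT_comp mk).
Qed.

Lemma bessel_riesz_ge0 n (cstar b N : R) (x y : 'rV[R]_n) : 0 <= N ->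
  2 * N * Num.sqrt n%:R < cstar -> cube N x -> cube N y ->
  (0 <= bessel_riesz_kernel cstar b (enorm (x - y)))%E.
Proof.
move=> N0 Nc xN yN; rewrite /bessel_riesz_kernel.
case: ifP => // _; case: eqP => [_|e0]; first by [].
case: ifP => _; last by rewrite lee_fin powR_ge0.
have e1 : 0 < enorm (x - y) by rewrite lt_neqAle eq_sym; apply/andP; split; [exact/eqP|exact: enorm_ge0].
rewrite lee_fin ln_ge0// ler_pdivlMr//.
by rewrite mul1r; apply: le_trans (cube_edist N0 xN yN) (ltW Nc).
Qed.

Lemma measurable_bessel_dist d (T : measurableType d) n cstar b (f g : T -> 'rV[R]_n) :
  measurable_fun setT f -> measurable_fun setT g ->
  measurable_fun setT (fun t => bessel_riesz_kernel cstar b (enorm (f t - g t))).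
Proof.
move=> mf mg; rewrite (_ : (fun _ => _) = (fun t => bessel_riesz_kernel cstar b `|enorm (f t - g t)|)).
  apply: (measurableT_comp (measurable_bessel_riesz _ _)).
  apply: (measurableT_comp (@measurable_enorm n)).
  exact: measurable_fun_rVB.
by apply/funext => t; rewrite ger0_norm// enorm_ge0.
Qed.

End kernels.

Section infinite_energy.
Context {R : realType}.

Definition near_pairs n (A : set 'rV[R]_n) (r : R) : set ('rV[R]_n * 'rV[R]_n) :=
  [set p | A p.1 /\ A p.2 /\ `|p.2 - p.1| <= r].

Lemma measurable_near_pairs n (A : set 'rV[R]_n) r : measurable A ->
  measurable (near_pairs A r).
Proof.
move=> mA.
have -> : near_pairs A r = (A `*` A) `&` (fun p => `|p.2 - p.1| : R) @^-1` `]-oo, r]%classic.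
  apply/seteqP; split => p; rewrite /near_pairs/= in_itv/=.
    by move=> [? []].
  by move=> [[? ?] ?].
apply: measurableI; first exact: measurableX.
rewrite -[X in measurable X]setTI; apply: measurable_fun_dist => //.
Qed.

(** A probability measure on a cube cannot spread too thinly: the second moment
    inequality, applied to the incidence relation between [mu] and Lebesgue
    measure on the cube, bounds from below the [mu x mu]-mass of the pairs at
    distance at most [2 t] by a multiple of [t ^ n]. *)
Lemma near_pairs_mass n (mu : {finite_measure set 'rV[R]_n -> \bar R}) (A : set 'rV[R]_n) (N t : R) :
  measurable A -> A `<=` cube N -> mu A = 1%E -> 0 < t -> t <= N ->
  (((t / (16 * N)) ^+ n)%:E <= \int[mu]_x mu (xsection (near_pairs A (2 * t)) x))%E.
Proof.
move=> mA AN A1 t0 tN.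
have N0 : 0 < N by exact: lt_le_trans tN.
set M := (X in (_ <= X)%E).
have M0 : (0 <= M)%E by apply: integral_ge0 => x _; exact: measure_ge0.
have [Mfin|] := boolP (M \is a fin_num); last first.
  by rewrite ge0_fin_numE// -leNgt leye_eq => /eqP ->; rewrite leey.
pose H := [set p : 'rV[R]_n * 'rV[R]_n | A p.1 /\ cube N p.2 /\ `|p.2 - p.1| <= t].
have mH : measurable H.
  have -> : H = (A `*` cube N) `&` (fun p => `|p.2 - p.1| : R) @^-1` `]-oo, t]%classic.
    apply/seteqP; split => p; rewrite /H/= in_itv/=.
      by move=> [? []].
    by move=> [[? ?] ?].
  apply: measurableI; first by apply: measurableX => //; exact: measurable_cube.
  rewrite -[X in measurable X]setTI; apply: measurable_fun_dist => //.
have HE x : A x -> xsection H x = cube N `&` cball x t.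
  move=> Ax; apply/seteqP; split => y; rewrite /xsection/= inE.
    by move=> [? []].
  by move=> [? ?]; split.
have H0 x : ~ A x -> xsection H x = set0.
  by move=> nA; apply/seteqP; split => y; rewrite // /xsection/= inE => -[].
have := @second_moment _ _ _ _ R mu (lebesgue_rV R n) H (t ^+ n) ((4 * t) ^+ n * fine M) ((4 * N) ^+ n) mH.
have t0' := ltW t0; have N0' := ltW N0.
rewrite !exprn_ge0 ?mulr_ge0 ?exprn_ge0 ?fine_ge0// ?mulr_ge0//.
move=> /(_ isT isT isT).
have h1 : ((t ^+ n)%:E <= \int[mu]_x lebesgue_rV R n (xsection H x))%E.
  apply: (@le_trans _ _ (\int[mu]_(x in A) (t ^+ n)%:E)%E).
    rewrite integral_cst//. by rewrite [X in (_ * X)%E]A1 mule1.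
  rewrite integral_mkcond; apply: ge0_integral_mono => x _; rewrite patchE; case: ifPn => //.
  - by rewrite lee_fin exprn_ge0.
  - move=> /set_mem Ax; rewrite HE//.
    by apply: lebesgue_cube_cball_ge => //; exact: AN.
  - by move=> _; exact: measure_ge0.
have h2 : (\int[mu]_x \int[mu]_y lebesgue_rV R n (xsection H x `&` xsection H y) <=
    ((4 * t) ^+ n * fine M)%:E)%E.
  rewrite EFinM fineK// /M -ge0_integralZl//; last 2 first.
  - by apply: measurable_fun_xsection; exact: measurable_near_pairs.
  - by rewrite lee_fin exprn_ge0// mulr_ge0.
  apply: ge0_integral_mono => x _; first by apply: integral_ge0.
  have mx := measurable_xsection x (measurable_near_pairs (2 * t) mA).
  rewrite -integral_cst// integral_mkcond; apply: ge0_integral_mono => y _ //.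
  rewrite patchE; case: ifPn => [_|].
    have [Ax|Ax] := pselect (A x); last first.
      by rewrite (H0 x)// set0I measure0 lee_fin exprn_ge0// mulr_ge0.
    apply: le_trans (lebesgue_cball_le x t0); apply: le_measure; rewrite ?inE.
    - by apply: measurableI; exact: measurable_xsection.
    - exact: measurable_cball.
    - by rewrite HE// => z [[]].
  move=> /negP xy.
  rewrite (_ : _ `&` _ = set0) ?measure0//; apply/seteqP; split => // z.
  rewrite /xsection/= !inE/= => -[[Ax [_ zx]] [Ay [_ zy]]]; apply: xy.
  rewrite mem_xsection inE/=; split => //; split => //=.
  rewrite -(subrKA z); apply: le_trans (ler_normD _ _) _.
  rewrite mulr_natl mulr2n; apply: lerD => //.
  by rewrite distrC.
have h3 : (lebesgue_rV R n [set w | 0 < mu (ysection H w)] <= ((4 * N) ^+ n)%:E)%E.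
  apply: (@le_trans _ _ (lebesgue_rV R n (cball 0 N))); last exact: lebesgue_cball_le.
  apply: le_measure; rewrite ?inE; last 2 first.
  - exact: measurable_cball.
  - move=> w /= hw; rewrite /cball/= subr0.
    have [[x]|] := pselect (ysection H w !=set0).
      rewrite /ysection/= inE => -[_ [wN _]]; apply/mxnorm_le => // i.
      by rewrite ler_norml; exact: wN.
    by move=> /set0P/negP/negPn/eqP H0w; move: hw; rewrite H0w measure0 ltxx.
  have mJ : measurable_fun setT (fun w => mu (ysection H w)) by exact: measurable_fun_ysection.
  rewrite (_ : [set w | _] = (fun w => mu (ysection H w)) @^-1` `]0%E, +oo[%classic).
    by rewrite -[X in measurable X]setTI; apply: mJ => //; exact: emeasurable_itv.
  by apply/seteqP; split => w; rewrite /= in_itv/= andbT.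
move=> /(_ h1 h2 h3) h.
rewrite -(fineK Mfin) lee_fin expr_div_n ler_pdivrMr ?exprn_gt0 ?mulr_gt0//.
have -> : 16 * N = 4 * (4 * N) by ring.
rewrite -(ler_pM2l (exprn_gt0 n t0)) -expr2; apply: le_trans h _.
by rewrite le_eqVlt; apply/orP; left; apply/eqP; rewrite !exprMn; ring.
Qed.

(** A geometric sum dominated by its last nonzero term. *)
Lemma dyadic_sum_le n (r N : R) K : (0 < n)%N -> 0 < r -> r <= N ->
  \sum_(k < K) (2 ^+ k) ^+ n * (r <= N / 2 ^+ k)%R%:R <= 2 * (N / r) ^+ n.
Proof.
move=> n0 r0 rN; have N0 : 0 < N by exact: lt_le_trans rN.
elim: K => [|K IH].
  by rewrite big_ord0 mulr_ge0// exprn_ge0// divr_ge0// ltW.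
rewrite big_ord_recr/=; case: (boolP (r <= _)) => [rK|_]; last by rewrite mulr0 addr0.
rewrite mulr1.
have E k : \sum_(k < k) (2 ^+ k) ^+ n * (r <= N / 2 ^+ k)%R%:R <= (2 ^+ k) ^+ n :> R.
  elim: k => [|k IHk]; first by rewrite big_ord0 expr0 expr1n.
  rewrite big_ord_recr/=; apply: (@le_trans _ _ ((2 ^+ k) ^+ n + (2 ^+ k) ^+ n)).
    by rewrite lerD// ler_piMr ?exprn_ge0// lern1 leq_b1.
  have h : (2 : R) <= 2 ^+ n by rewrite ler_eXnr// ler1n.
  rewrite -[X in X + _]mul1r -[X in _ + X]mul1r -mulrDl exprS exprMn.
  by rewrite ler_wpM2r ?exprn_ge0.
apply: (@le_trans _ _ ((2 ^+ K) ^+ n + (2 ^+ K) ^+ n)); first by rewrite lerD2r; exact: E.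
rewrite -[X in X + _]mul1r -[X in _ + X]mul1r -mulrDl ler_wpM2l// lerXn2r ?nnegrE ?exprn_ge0// ?divr_ge0 ?(ltW N0) ?(ltW r0)//.
by rewrite ler_pdivlMr// mulrC -ler_pdivlMr ?exprn_gt0.
Qed.

(** The kernel dominates a sum over dyadic scales [2 ^- k] of [2 ^ (k n)] times the
    indicator of pairs at that scale. By [near_pairs_mass] each scale contributes
    a fixed amount, and there are infinitely many scales. *)
Lemma energy_ge_dim n (mu : probability 'rV[R]_n R) (A : set 'rV[R]_n) (cstar b N : R) :
  (0 < n)%N -> 0 < N -> measurable A -> A `<=` cube N -> mu A = 1%E -> n%:R <= b ->
  energy cstar b A mu = +oo%E.
Proof.
move=> n0 N0 mA AN A1 nb.
have b0 : 0 < b by rewrite (lt_le_trans _ nb)// ltr0n.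
have N20 : 0 < 2 * N by rewrite mulr_gt0.
have s0 : 0 < Num.sqrt n%:R :> R by rewrite sqrtr_gt0 ltr0n.
pose c := (Num.sqrt n%:R * (2 * N)) `^ (- b) / 2.
have c0 : 0 < c by rewrite divr_gt0// powR_gt0// mulr_gt0.
pose g K (x y : 'rV[R]_n) : R := \sum_(k < K) (2 ^+ k) ^+ n * (`|y - x| <= 2 * N / 2 ^+ k)%R%:R.
(* c collects the passage from the Euclidean to the sup norm, and from b to n *)
have kb K x y : A x -> A y -> ((c * g K x y)%:E <= bessel_riesz_kernel cstar b (enorm (x - y)))%E.
  move=> Ax Ay; rewrite /bessel_riesz_kernel ltNge (ltW b0)/= enorm_eq0 subr_eq0.
  have [//|xy] := eqVneq x y; first by rewrite leey.
  rewrite gt_eqF// lee_fin.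
  have r0 : 0 < `|y - x| by rewrite normr_gt0 subr_eq0 eq_sym.
  have rN : `|y - x| <= 2 * N by apply: cube_dist => //; [exact: ltW|exact: AN|exact: AN].
  apply: (@le_trans _ _ (c * (2 * ((2 * N) / `|y - x|) `^ b))).
    rewrite ler_wpM2l ?(ltW c0)//; apply: le_trans (dyadic_sum_le _ n0 r0 rN) _.
    rewrite ler_wpM2l// -powR_mulrn ?divr_ge0 ?(ltW N20)// ler_powR//.
    by rewrite ler_pdivlMr// mul1r.
  rewrite /c mulrA divfK// !powRN.
  rewrite (_ : (Num.sqrt n%:R * (2 * N)) `^ b =
      (Num.sqrt n%:R * `|y - x|) `^ b * (2 * N / `|y - x|) `^ b); last first.
    rewrite -powRM ?mulr_ge0 ?invr_ge0 ?(ltW N0) ?(ltW s0)//.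
    by congr (_ `^ _); field; rewrite gt_eqF.
  rewrite invfM divfK; last by rewrite gt_eqF// powR_gt0// divr_gt0.
  rewrite lef_pV2 ?posrE ?powR_gt0 ?mulr_gt0//; last first.
    by rewrite lt_neqAle eq_sym enorm_eq0 subr_eq0 xy enorm_ge0.
  apply: ge0_ler_powR; rewrite ?nnegrE ?(ltW b0) ?enorm_ge0 ?mulr_ge0 ?sqrtr_ge0//.
  by rewrite distrC; exact: enorm_le_mxnorm.
have EK (K : nat) : ((c / 32 ^+ n * K%:R)%:E <= energy cstar b A mu)%E.
  pose h (k : nat) x := mu (xsection (near_pairs A (2 * N / 2 ^+ k)) x).
  have mh k : measurable_fun setT (h k).
    by apply: measurable_fun_xsection; exact: measurable_near_pairs.
  apply: (@le_trans _ _ (\int[mu]_x (\sum_(k < K) (c * (2 ^+ k) ^+ n)%:E * h k x))%E).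
    rewrite ge0_integral_sum//; last 2 first.
    - by move=> k; apply: measurable_funeM; exact: mh.
    - by move=> k x _; rewrite mule_ge0// lee_fin mulr_ge0 ?(ltW c0)// !exprn_ge0.
    have -> : (c / 32 ^+ n * K%:R)%:E = (\sum_(k < K) (c / 32 ^+ n)%:E)%E.
      by rewrite sumEFin big_const_ord iter_addr_0 mulr_natr.
    apply: lee_sum => k _; rewrite ge0_integralZl//; last first.
      by rewrite lee_fin mulr_ge0 ?(ltW c0)// !exprn_ge0.
    have tk0 : 0 < N / 2 ^+ k by rewrite divr_gt0// exprn_gt0.
    have tkN : N / 2 ^+ k <= N by rewrite ler_pdivrMr ?exprn_gt0// ler_peMr ?(ltW N0)// exprn_ege1// ler1n.
    have := near_pairs_mass mA AN A1 tk0 tkN; rewrite mulrA => hk.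
    apply: le_trans (lee_wpmul2l _ hk); last by rewrite lee_fin mulr_ge0 ?(ltW c0)// !exprn_ge0.
    rewrite -EFinM lee_fin -[leRHS]mulrA ler_wpM2l ?(ltW c0)//.
    rewrite -exprMn -exprVn lerXn2r ?nnegrE// ?invr_ge0// ?mulr_ge0 ?invr_ge0 ?exprn_ge0 ?mulr_ge0 ?(ltW N0)//.
    rewrite (_ : _ * _ = 16^-1); first by rewrite lef_pV2 ?posrE// ler_nat.
    by field; rewrite gt_eqF ?gt_eqF// exprn_gt0.
  rewrite /energy [leRHS]integral_mkcond; apply: ge0_integral_mono => x _.
    by apply: sume_ge0 => k _; rewrite mule_ge0// lee_fin mulr_ge0 ?(ltW c0)// !exprn_ge0.
  rewrite patchE; case: ifPn => [/set_mem Ax|/negP nAx]; last first.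
    rewrite big1// => k _; rewrite /h (_ : xsection _ _ = set0) ?measure0 ?mule0//.
    by apply/seteqP; split => // y; rewrite /xsection/= inE => -[/= Ax]; case: nAx; exact: mem_set.
  apply: (@le_trans _ _ (\int[mu]_(y in A) (c * g K x y)%:E)%E); last first.
    apply: ge0_integral_mono => y Ay; last exact: kb.
    by rewrite lee_fin mulr_ge0 ?(ltW c0)// sumr_ge0// => k _; rewrite mulr_ge0// !exprn_ge0.
  under [leRHS]eq_integral do rewrite /g mulr_sumr -sumEFin.
  rewrite ge0_integral_sum//; last 2 first.
  - move=> k; apply/measurable_EFinP; apply: measurable_funM => //.
    apply: measurable_funM => //.
    apply: measurable_funTS.
    rewrite (_ : (fun _ => _) = \1_(cball x (2 * N / 2 ^+ k))).
      by apply: measurable_indic; exact: measurable_cball.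
    by apply/funext => y; rewrite indicE; congr (_%:R); congr nat_of_bool; apply/idP/idP; rewrite inE.
  - by move=> k y _; rewrite lee_fin mulr_ge0 ?(ltW c0)// mulr_ge0// !exprn_ge0.
  apply: lee_sum => k _.
  rewrite /h -integral_cst; last by apply: measurable_xsection; exact: measurable_near_pairs.
  rewrite integral_mkcond [leRHS]integral_mkcond; apply: ge0_integral_mono => y _.
    by rewrite patchE; case: ifPn => // _; rewrite lee_fin mulr_ge0 ?(ltW c0)// !exprn_ge0.
  rewrite !patchE; case: ifPn => [|_]; last first.
    by case: ifPn => // _; rewrite lee_fin mulr_ge0 ?(ltW c0)// mulr_ge0// !exprn_ge0.
  by rewrite inE /xsection/= inE => -[/= _ [Ay yx]]; rewrite mem_set// yx mulr1.
apply: eq_infty => t; pose K := (Num.truncn (`|t| / (c / 32 ^+ n))).+1.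
have c1 : 0 < c / 32 ^+ n by rewrite divr_gt0// exprn_gt0.
apply: le_trans (EK K); rewrite lee_fin mulrC -ler_pdivrMr//.
apply: (@le_trans _ _ (`|t| / (c / 32 ^+ n))).
  by rewrite ler_pM2r ?invr_gt0// ler_norm.
have q0 : 0 <= `|t| / (c / 32 ^+ n) by rewrite divr_ge0// ltW.
by have /andP[_ /ltW] := truncn_itv q0.
Qed.

End infinite_energy.

(** * Space and time integrals of the density bound *)

Section potentials.
Context {R : realType}.

(** Averaging [|v - u| ^- th] over a ball of radius [e] smooths it at scale [e]: if
    the centres are closer than [4 e], the ball lies in a ball of radius [6 e]
    about [u] and [rpow_cball] applies; otherwise [|v - u|] is comparable to the
    distance of the centres. *)
Lemma average_rpow n (th : R) : (0 < n)%N -> 0 <= th -> th < n%:R ->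
  exists2 C : R, 0 < C & forall (z1 z2 u : 'rV[R]_n) e, 0 < e -> cball z1 e u ->
    (\int[lebesgue_rV R n]_(v in cball z2 e) rpow th `|(v - u)%R| <=
     (C * e ^+ n * (Num.max `|z2 - z1| e) `^ (- th))%:E)%E.
Proof.
move=> n0 th0 thn.
have [Cd Cd0 CdE] : exists2 C : R, 0 < C & 8 ^+ n / (1 - 2 `^ (th - n%:R)) = C.
  eexists; last reflexivity.
  by rewrite divr_gt0 ?exprn_gt0// subr_gt0 powR2_lt1// subr_lt0.
exists (Cd * 6 `^ (n%:R - th) * 4 `^ th + 2 `^ th * 4 ^+ n).
  have h1 := mulr_gt0 (mulr_gt0 Cd0 (powR_gt0 (n%:R - th) (ltr0Sn R 5))) (powR_gt0 th (ltr0Sn R 3)).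
  have h2 := mulr_gt0 (powR_gt0 th (ltr0Sn R 1)) (exprn_gt0 n (ltr0Sn R 3)).
  exact: addr_gt0 h1 h2.
move=> z1 z2 u e e0 ue; set q := Num.max _ _.
have e0' := ltW e0.
have q0 : 0 < q by rewrite lt_max e0 orbT.
have mr : measurable_fun setT (fun v : 'rV[R]_n => rpow th `|v - u|) by exact: measurable_rpow_dist.
have [zz|zz] := leP `|z2 - z1| (4 * e).
  apply: (@le_trans _ _ (\int[lebesgue_rV R n]_(v in cball u (6 * e)) rpow th `|(v - u)%R|)%E).
    apply: ge0_subset_integral => //; [exact: measurable_cball|exact: measurable_cball| | |].
    - exact: measurable_funTS.
    - by move=> v _; exact: rpow_ge0.
    move=> v; rewrite /cball/= => ve.
    have -> : v - u = (v - z2) + (z2 - z1) + (z1 - u).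
      by rewrite !subrKA.
    apply: le_trans (ler_normD _ _) _.
    have := ler_normD (v - z2) (z2 - z1); move: ue; rewrite /cball/= distrC.
    by lra.
  apply: le_trans (rpow_cball u n0 th0 thn _) _; first by rewrite mulr_gt0.
  rewrite lee_fin CdE powRM// [e `^ _]powRD; last by rewrite (gt_eqF e0) implybT.
  rewrite powR_mulrn//.
  have qe : e `^ (- th) <= 4 `^ th * q `^ (- th).
    rewrite !powRN ler_pdivlMr ?powR_gt0// mulrC ler_pdivrMr ?powR_gt0//.
    rewrite -powRM//; apply: ge0_ler_powR; rewrite ?nnegrE ?(ltW q0) ?mulr_ge0//.
    by rewrite ge_max zz/= ler_peMl// ler1n.
  rewrite !mulrDl; apply: ler_wpDr; first by rewrite !mulr_ge0 ?powR_ge0 ?exprn_ge0.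
  rewrite !mulrA -(mulrA _ (4 `^ th)) (mulrC (4 `^ th)) mulrA -(mulrA _ (4 `^ th)).
  by rewrite ler_wpM2l// !mulr_ge0 ?powR_ge0 ?exprn_ge0 ?(ltW Cd0).
have qE : q = `|z2 - z1|.
  by rewrite /q; apply/max_idPl; apply: le_trans (ltW zz); rewrite ler_peMl// ler1n.
apply: (@le_trans _ _ (\int[lebesgue_rV R n]_(v in cball z2 e) ((q / 2) `^ (- th))%:E)%E).
  apply: ge0_integral_mono => v; first by rewrite rpow_ge0.
  rewrite /cball/= => ve; apply: rpow_le => //; first by rewrite divr_gt0.
  have h1 := ler_normD (z2 - v) (v - u).
  have h2 := ler_normD (z2 - v + (v - u)) (u - z1).
  move: h1 h2 ve ue zz; rewrite !subrKA /cball/= qE (distrC z2 v).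
  by lra.
rewrite integral_cst; last exact: measurable_cball.
apply: (@le_trans _ _ (((q / 2) `^ (- th))%:E * ((4 * e) ^+ n)%:E)%E).
  by rewrite lee_wpmul2l ?lee_fin ?powR_ge0//; exact: lebesgue_cball_le.
rewrite -EFinM lee_fin [X in _ <= X * _]mulrDl [leRHS]mulrDl; apply: ler_wpDl.
  by rewrite !mulr_ge0 ?powR_ge0 ?exprn_ge0 ?(ltW Cd0).
have h2 : (2 : R)^-1 `^ (- th) = 2 `^ th by rewrite powR_invr// opprK.
rewrite powRM ?(ltW q0) ?invr_ge0// h2 [(4 * e) ^+ n]exprMn.
by rewrite le_eqVlt; apply/orP; left; apply/eqP; ring.
Qed.

(** This is [ln y <= y] at [y = X / a]. *)
Lemma expRN_le_powR (a X : R) : 0 < a -> 0 < X -> expR (- X) <= (a / X) `^ a.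
Proof.
move=> a0 X0; rewrite /powR mulf_eq0 invr_eq0 !gt_eqF//= ler_expR.
rewrite -[X in ln X]invf_div lnV ?posrE ?divr_gt0// mulrN lerN2.
rewrite mulrC -ler_pdivlMr//; apply: le_trans (ltW (ln_sublinear _)) _ => //.
by rewrite divr_gt0.
Qed.

(** The Gaussian factor of the density is only used through polynomial decay of a
    well chosen order [th]. *)
Lemma exp_le_rpow (al c th : R) : 0 < c -> 0 < th ->
  exists2 M : R, 0 < M & forall r s, 0 < r -> 0 < s ->
    expR (- (c * r ^+ 2 / s `^ al)) <= M * s `^ (al * th / 2) * r `^ (- th).
Proof.
move=> c0 th0; exists ((th / 2 / c) `^ (th / 2)).
  by rewrite powR_gt0// !divr_gt0.
move=> r s r0 s0.
have h0 : 0 < th / 2 by rewrite divr_gt0.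
have hX : 0 < c * r ^+ 2 / s `^ al by rewrite divr_gt0 ?powR_gt0// mulr_gt0// exprn_gt0.
apply: le_trans (expRN_le_powR h0 hX) _.
rewrite (_ : th / 2 / _ = th / 2 / c * s `^ al * r `^ (- 2)); last first.
  rewrite powRN powR_mulrn ?(ltW r0)//; field.
  by rewrite ?gt_eqF ?powR_gt0 ?exprn_gt0.
rewrite !powRM ?mulr_ge0 ?powR_ge0 ?invr_ge0 ?(ltW c0) ?(ltW th0)//.
rewrite -!powRrM le_eqVlt; apply/orP; left; apply/eqP.
by congr (_ * _ `^ _ * _ `^ _); field.
Qed.

Lemma ex_pow2_ge (t : R) : exists K : nat, t <= 2 ^+ K /\ K%:R * ln 2 <= ln 2 + `|ln t|.
Proof.
have l2 : 0 < ln 2 :> R by rewrite ln_gt0// ltr1n.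
have [t1|t1] := leP t 1.
  by exists 0%N; rewrite expr0 mul0r addr_ge0// ltW.
have t0 : 0 < t by exact: lt_trans t1.
have y0 : 0 <= ln t / ln 2 by rewrite divr_ge0 ?(ltW l2)// ln_ge0// ltW.
have /andP[h1 h2] := truncn_itv y0.
exists (Num.truncn (ln t / ln 2)).+1; split.
  rewrite -ler_ln ?posrE ?exprn_gt0//.
  have -> k : ln (2 ^+ k) = k%:R * ln 2 :> R by rewrite lnXn// mulr_natl.
  by rewrite -ler_pdivrMr// ltW.
rewrite -natr1 mulrDl mul1r addrC lerD2l; apply: le_trans (ler_norm _).
by rewrite -ler_pdivlMr.
Qed.

Lemma shell_sub n (x : 'rV[R]_n) r s t : s <= t -> shell x r s `<=` shell x r t.
Proof. by move=> st y /andP[ry ys]; rewrite /shell/= ry (le_trans ys). Qed.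

(** The two pieces of the time integral of the density bound, split at
    [rho = q ^ (2 / al)], the time scale at which the process typically moves by
    [q]. The inner piece is of order [rho ^ (m - ga) = q ^ (- b)] thanks to
    [b < th], the outer one is of order 1, [log (D / rho)] or [rho ^ (m - ga)]
    according to the sign of [b = 2 / al * (ga - m)]; these are the three cases of
    the Bessel-Riesz kernel. *)
Lemma potential_le_bessel m (ga al th cstar rmax s Q D : R) : (0 < m)%N ->
  0 < ga -> 0 < al -> 0 < th -> 2 / al * (ga - m%:R) < th -> al * th / 2 <= ga ->
  0 < rmax -> rmax < cstar -> 0 < s -> 0 < Q -> 0 < D ->
  exists2 T : R, 0 < T & forall (x : 'rV[R]_m) q r, 0 < q -> q <= Q ->
    0 <= r -> r <= rmax -> r <= s * q ->
    (\int[lebesgue_rV R m]_(y in cball x (q `^ (2 / al)))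
        ((q `^ (- th))%:E * rpow (ga - al * th / 2)%R `|(y - x)%R|) +
     \int[lebesgue_rV R m]_(y in shell x (q `^ (2 / al)) D) rpow ga `|(y - x)%R| <=
     T%:E * bessel_riesz_kernel cstar (2 / al * (ga - m%:R)) r)%E.
Proof.
move=> m0 ga0 al0 th0 bth alth rm0 rmc s0 Q0 D0.
set b := 2 / al * _; set a := ga - al * th / 2.
have a0 : 0 <= a by rewrite subr_ge0.
have am : a < m%:R.
  move: bth; rewrite /b mulrAC ltr_pdivrMr// /a => h.
  by rewrite ltrBlDr -ltrBlDl ltr_pdivlMr// mulrC [al * th]mulrC.
have [C1 C10 C1E] : exists2 C : R, 0 < C & 8 ^+ m / (1 - 2 `^ (a - m%:R)) = C.
  eexists; last reflexivity.
  by rewrite divr_gt0 ?exprn_gt0// subr_gt0 powR2_lt1// subr_lt0.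
have near x q : 0 < q ->
  (\int[lebesgue_rV R m]_(y in cball x (q `^ (2 / al)))
        ((q `^ (- th))%:E * rpow a `|(y - x)%R|) <= (C1 * q `^ (- b))%:E)%E.
  move=> q0; have rho0 : 0 < q `^ (2 / al) by rewrite powR_gt0.
  rewrite ge0_integralZl//; last 4 first.
  - exact: measurable_cball.
  - by apply: measurable_funTS; exact: measurable_rpow_dist.
  - by move=> y _; exact: rpow_ge0.
  - by rewrite lee_fin powR_ge0.
  apply: le_trans (lee_wpmul2l _ (rpow_cball x m0 a0 am rho0)) _.
    by rewrite lee_fin powR_ge0.
  rewrite -EFinM lee_fin C1E mulrCA ler_wpM2l ?(ltW C10)// -powRrM -powRD; last first.
    by rewrite (gt_eqF q0) implybT.
  rewrite le_eqVlt; apply/orP; left; apply/eqP; congr (_ `^ _).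
  by rewrite /a /b; field; rewrite gt_eqF.
have mr x : measurable_fun setT (fun y : 'rV[R]_m => rpow ga `|y - x|) by exact: measurable_rpow_dist.
have [b_lt0|b_gt0|b_eq0] := ltgtP b 0.
- (* for ga < m the power ga is integrable at the origin of R^m, so both
     integrals are bounded, and the Bessel-Riesz kernel is 1 *)
  have gam : ga < m%:R by move: b_lt0; rewrite /b pmulr_rlt0 ?divr_gt0// subr_lt0.
  have [C2 C20 C2E] : exists2 C : R, 0 < C & 8 ^+ m / (1 - 2 `^ (ga - m%:R)) * D `^ (m%:R - ga) = C.
    eexists; last reflexivity.
    by rewrite mulr_gt0 ?powR_gt0// divr_gt0 ?exprn_gt0// subr_gt0 powR2_lt1// subr_lt0.
  exists (C1 * Q `^ (- b) + C2); first by rewrite addr_gt0// mulr_gt0// powR_gt0.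
  move=> x q r q0 qQ r0 rrm rsq.
  rewrite /bessel_riesz_kernel b_lt0 mule1 EFinD; apply: leeD.
    apply: le_trans (near x q q0) _; rewrite lee_fin ler_wpM2l ?(ltW C10)//.
    by apply: ge0_ler_powR; rewrite ?nnegrE ?(ltW q0) ?(ltW Q0)// oppr_ge0 ltW.
  rewrite -C2E; apply: le_trans (rpow_cball x m0 (ltW ga0) gam D0).
  apply: ge0_subset_integral => //; [exact: measurable_shell|exact: measurable_cball| | |].
  + exact: measurable_funTS.
  + by move=> v _; exact: rpow_ge0.
  + by move=> y /andP[].
- (* for ga > m the far integral is dominated by its lower end rho, and
     rho ^ (m - ga) = q ^ (- b) *)
  have mga : m%:R < ga by move: b_gt0; rewrite /b pmulr_rgt0 ?divr_gt0// subr_gt0.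
  have [C2 C20 C2E] : exists2 C : R, 0 < C & 8 ^+ m / (1 - 2 `^ (m%:R - ga)) = C.
    eexists; last reflexivity.
    by rewrite divr_gt0 ?exprn_gt0// subr_gt0 powR2_lt1// subr_lt0.
  exists ((C1 + C2) * s `^ b); first by rewrite mulr_gt0 ?powR_gt0// addr_gt0.
  move=> x q r q0 qQ r0 rrm rsq.
  rewrite /bessel_riesz_kernel ltNge (ltW b_gt0)/= (gt_eqF b_gt0).
  case: eqP => [_|/eqP rn0].
    by rewrite gt0_muley ?leey// lte_fin mulr_gt0 ?powR_gt0// addr_gt0.
  have {}r0 : 0 < r by rewrite lt_neqAle eq_sym rn0.
  have rho0 : 0 < q `^ (2 / al) by rewrite powR_gt0.
  apply: (@le_trans _ _ ((C1 + C2) * q `^ (- b))%:E).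
    rewrite [(C1 + C2) * _]mulrDl EFinD; apply: leeD; first exact: near.
    have [K [hK _]] := ex_pow2_ge (D / q `^ (2 / al)).
    move: hK; rewrite ler_pdivrMr// => hK.
    apply: (@le_trans _ _ (\int[lebesgue_rV R m]_(y in shell x (q `^ (2 / al)) (2 ^+ K * q `^ (2 / al))) rpow ga `|(y - x)%R|)%E).
      apply: ge0_subset_integral => //; [exact: measurable_shell|exact: measurable_shell| | |].
      + exact: measurable_funTS.
      + by move=> v _; exact: rpow_ge0.
      + exact: shell_sub.
    apply: le_trans (rpow_shell_up x K mga rho0) _; rewrite lee_fin C2E.
    rewrite ler_wpM2l ?(ltW C20)// -powRrM le_eqVlt; apply/orP; left; apply/eqP.
    by congr (_ `^ _); rewrite /b -mulrN opprB.
  rewrite -EFinM lee_fin -mulrA ler_wpM2l ?addr_ge0 ?(ltW C10) ?(ltW C20)//.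
  rewrite !powRN -ler_pdivrMl ?powR_gt0// mulrC -invfM -powRM ?(ltW s0) ?(ltW q0)//.
  rewrite lef_pV2 ?posrE ?powR_gt0 ?mulr_gt0//.
  by apply: ge0_ler_powR; rewrite ?nnegrE ?(ltW b_gt0) ?(ltW r0) ?mulr_ge0 ?(ltW s0) ?(ltW q0)// mulrC.
(* for ga = m each dyadic shell contributes a constant, and there are about
   log (D / rho) shells between rho and D; the additive constants are absorbed
   because log (cstar / r) stays above L0 > 0 *)
have gam : ga = m%:R.
  by apply/eqP; rewrite -subr_eq0; move/eqP: b_eq0; rewrite /b mulf_eq0 gt_eqF ?divr_gt0.
pose L0 := ln (cstar / rmax).
have L00 : 0 < L0 by rewrite ln_gt0// ltr_pdivlMr// mul1r.
have l2 : 0 < ln 2 :> R by rewrite ln_gt0// ltr1n.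
have c0 : 0 < cstar by exact: lt_trans rmc.
pose B := `|ln D| + 2 / al * (`|ln s| + `|ln cstar| + `|ln Q|).
have B0 : 0 <= B by rewrite addr_ge0// mulr_ge0 ?addr_ge0// divr_ge0// ltW.
pose T := (C1 + 8 ^+ m * (1 + B / ln 2)) / L0 + 8 ^+ m * (2 / al) / ln 2.
have T1 : 0 <= 8 ^+ m * (1 + B / ln 2) by rewrite mulr_ge0 ?exprn_ge0// addr_ge0// divr_ge0// ltW.
have T2 : 0 <= 8 ^+ m * (2 / al) / ln 2.
  by rewrite !mulr_ge0 ?exprn_ge0// ?invr_ge0 ltW.
have T0 : 0 < T.
  by rewrite ltr_pwDl// divr_gt0// ltr_pwDl.
exists T => // x q r q0 qQ r0 rrm rsq.
rewrite /bessel_riesz_kernel b_eq0 ltxx eqxx.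
case: eqP => [_|/eqP rn0]; first by rewrite gt0_muley ?leey.
have {}r0 : 0 < r by rewrite lt_neqAle eq_sym rn0.
have rho0 : 0 < q `^ (2 / al) by rewrite powR_gt0.
pose L := ln (cstar / r).
have LL : L0 <= L.
  rewrite ler_ln ?posrE ?divr_gt0// ler_pM2l// lef_pV2//.
have [K [hK1 hK2]] := ex_pow2_ge (D / q `^ (2 / al)).
have lnq : `|ln q| <= `|ln s| + `|ln cstar| + `|ln Q| + L.
  have h1 : ln q <= ln Q by rewrite ler_ln.
  have h2 : ln r <= ln s + ln q by rewrite -lnM// ler_ln// posrE mulr_gt0.
  have h3 : L = ln cstar - ln r by rewrite /L ln_div.
  have h4 : 0 <= L by rewrite (le_trans (ltW L00)).
  have := ler_norm (ln Q); have := ler_norm (ln s); have := ler_norm (ln cstar).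
  have := normr_ge0 (ln Q); have := normr_ge0 (ln s); have := normr_ge0 (ln cstar).
  have := ler_norm (- ln Q); have := ler_norm (- ln s); have := ler_norm (- ln cstar).
  rewrite !normrN ler_norml => *; apply/andP; split; lra.
have hK : K%:R <= 1 + B / ln 2 + 2 / al / ln 2 * L.
  have : K%:R * ln 2 <= ln 2 + B + 2 / al * L.
    apply: le_trans hK2 _; rewrite -addrA lerD2l.
    rewrite ln_div ?posrE// ln_powR; apply: le_trans (ler_normB _ _) _.
    rewrite /B -addrA lerD2l normrM -mulrDr ger0_norm ?divr_ge0 ?(ltW al0)//.
    by rewrite ler_wpM2l ?divr_ge0 ?(ltW al0).
  rewrite -ler_pdivlMr// => h; apply: le_trans h _.
  by rewrite le_eqVlt; apply/orP; left; apply/eqP; field; rewrite !gt_eqF.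
apply: (@le_trans _ _ (C1 + 8 ^+ m * K%:R)%:E).
  rewrite EFinD; apply: leeD.
    by apply: le_trans (near x q q0) _; rewrite b_eq0 oppr0 powRr0 mulr1.
  rewrite gam.
  move: hK1; rewrite ler_pdivrMr// => hK1.
  apply: le_trans (rpow_shell_critical x K rho0).
  apply: ge0_subset_integral => //; [exact: measurable_shell|exact: measurable_shell| | |].
  + by rewrite -gam; exact: measurable_funTS.
  + by move=> v _; exact: rpow_ge0.
  + exact: shell_sub.
rewrite -EFinM lee_fin -/L.
apply: (@le_trans _ _ (C1 + 8 ^+ m * (1 + B / ln 2 + 2 / al / ln 2 * L))).
  by rewrite lerD2l ler_wpM2l// exprn_ge0.
have -> : T * L = (C1 + 8 ^+ m * (1 + B / ln 2)) / L0 * L + 8 ^+ m * (2 / al) / ln 2 * L.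
  by rewrite /T; ring.
have -> : C1 + 8 ^+ m * (1 + B / ln 2 + 2 / al / ln 2 * L) =
    (C1 + 8 ^+ m * (1 + B / ln 2)) + 8 ^+ m * (2 / al) / ln 2 * L by ring.
by rewrite lerD2r mulrAC ler_pdivlMr// ler_wpM2l ?addr_ge0 ?(ltW C10).
Qed.

(** Each of the two bounds on [g] is used on the side of [rho] where it is the
    better one; at [y = x] the right-hand side is infinite. *)
Lemma time_integral_le m (ga a A0 D rho Z : R) (x : 'rV[R]_m) (E : set 'rV[R]_m) (g : 'rV[R]_m -> \bar R) :
  0 < A0 -> 0 < rho -> 0 < Z -> E `<=` cball x D -> (forall y, 0 <= g y)%E ->
  (forall y, E y -> y <> x -> (g y <= (A0 * `|y - x| `^ (- ga))%:E)%E) ->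
  (forall y, E y -> y <> x -> (g y <= (A0 * (Z * `|y - x| `^ (- a)))%:E)%E) ->
  (\int[lebesgue_rV R m]_(y in E) g y <=
    A0%:E * (\int[lebesgue_rV R m]_(y in cball x rho) (Z%:E * rpow a `|(y - x)%R|) +
     \int[lebesgue_rV R m]_(y in shell x rho D) rpow ga `|(y - x)%R|))%E.
Proof.
move=> A00 rho0 Z0 ED g0 g1 g2.
pose f1 := fun y : 'rV[R]_m => (Z%:E * rpow a `|(y - x)%R|)%E.
pose f2 := fun y : 'rV[R]_m => rpow ga `|(y - x)%R|.
have f10 y : (0 <= f1 y)%E by rewrite mule_ge0 ?rpow_ge0// lee_fin ltW.
have f20 y : (0 <= f2 y)%E by exact: rpow_ge0.
have mf1 : measurable_fun setT f1 by apply: measurable_funeM; exact: measurable_rpow_dist.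
have mf2 : measurable_fun setT f2 by exact: measurable_rpow_dist.
rewrite (integral_mkcond (cball x rho)) (integral_mkcond (shell x rho D)).
have m1 : measurable_fun setT (f1 \_ (cball x rho)).
  apply/(measurable_restrictT _ _).1 => //; first exact: measurable_cball.
  exact: measurable_funTS.
have m2 : measurable_fun setT (f2 \_ (shell x rho D)).
  apply/(measurable_restrictT _ _).1 => //; first exact: measurable_shell.
  exact: measurable_funTS.
have p1 y : (0 <= (f1 \_ (cball x rho)) y)%E by rewrite patchE; case: ifP.
have p2 y : (0 <= (f2 \_ (shell x rho D)) y)%E by rewrite patchE; case: ifP.
rewrite -ge0_integralD// -ge0_integralZl//; last 3 first.
- exact: emeasurable_funD.
- by move=> y _; rewrite adde_ge0.
- by rewrite lee_fin ltW.
rewrite (integral_mkcond E); apply: ge0_integral_mono => y _; rewrite patchE; case: ifPn => //; last first.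
  by move=> _; rewrite mule_ge0 ?adde_ge0 ?lee_fin ?(ltW A00).
move=> /set_mem Ey; rewrite patchE [X in (_ + X)%E]patchE.
have [yx|yx] := pselect (y = x).
  rewrite mem_set; last by rewrite /cball/= yx subrr normr0 ltW.
  rewrite memNset; last by rewrite /shell/= yx subrr normr0 ltNge (ltW rho0).
  by rewrite adde0 /f1 yx subrr normr0 /rpow eqxx !gt0_muley ?leey ?lte_fin.
have yx0 : `|y - x| != 0 by rewrite normr_eq0 subr_eq0; exact/eqP.
case: (leP `|y - x| rho) => yr.
  rewrite mem_set//; apply: le_trans (g2 y Ey yx) _.
  rewrite EFinM lee_wpmul2l ?lee_fin ?(ltW A00)// EFinM -rpowE//.
  by apply: leeDl; case: ifP => // _; exact: rpow_ge0.
rewrite memNset; last by rewrite /cball/=; apply/negP; rewrite -ltNge.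
rewrite mem_set; last by rewrite /shell/= yr; exact: ED.
by rewrite add0e; apply: le_trans (g1 y Ey yx) _; rewrite EFinM lee_wpmul2l ?lee_fin ?(ltW A00)// /f2 rpowE.
Qed.

End potentials.

(** * Joint hitting probabilities of two small balls *)

Section pair_estimates.
Context {R : realType}.

(** Balls are cut by the cube because the densities are controlled inside the
    cube only; by [lebesgue_cube_cball_ge] this costs a constant in volume. *)
Definition clipped n (N : R) (z : 'rV[R]_n) (e : R) : set 'rV[R]_n := cube N `&` cball z e.

Lemma measurable_clipped n N (z : 'rV[R]_n) e : measurable (clipped N z e).
Proof. by apply: measurableI; [exact: measurable_cube|exact: measurable_cball]. Qed.

Lemma lebesgue_clipped_le n N (z : 'rV[R]_n) e : 0 < e ->
  (lebesgue_rV R n (clipped N z e) <= ((4 * e) ^+ n)%:E)%E.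
Proof.
move=> e0; apply: le_trans (lebesgue_cball_le z e0); apply: le_measure; rewrite ?inE.
- exact: measurable_clipped.
- exact: measurable_cball.
- exact: subIsetr.
Qed.

Lemma density_rect_le n (nu : set ('rV[R]_n * 'rV[R]_n) -> \bar R) p (B1 B2 : set 'rV[R]_n) h :
  has_density (lebesgue_rV R n \x lebesgue_rV R n)%E nu p ->
  measurable B1 -> measurable B2 -> measurable_fun setT h ->
  (forall q, 0 <= h q)%E ->
  (forall u v, B1 u -> B2 v -> ((p (u, v))%:E <= h (u, v))%E) ->
  (nu (B1 `*` B2) <= \int[lebesgue_rV R n]_(u in B1) \int[lebesgue_rV R n]_(v in B2) h (u, v))%E.
Proof.
move=> [mp p0 dE] m1 m2 mh h0 ph; rewrite dE; last exact: measurableX.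
apply: (@le_trans _ _ (\int[lebesgue_rV R n \x lebesgue_rV R n]_(z in B1 `*` B2) h z)%E).
  apply: ge0_integral_mono => -[u v]; last by move=> [? ?]; exact: ph.
  by rewrite lee_fin.
rewrite integral_mkcond fubini_tonelli1; last 2 first.
- apply/(measurable_restrictT _ _).1; first exact: measurableX.
  exact: measurable_funTS.
- by move=> q; rewrite patchE; case: ifP.
rewrite [leRHS]integral_mkcond; apply: ge0_integral_mono => u _.
  by apply: integral_ge0 => v _; rewrite patchE; case: ifP.
rewrite patchE /fubini_F; case: ifPn => [/set_mem uB|/negP uB].
  rewrite [leRHS]integral_mkcond; apply: ge0_integral_mono => v _.
    by rewrite patchE; case: ifP.
  rewrite !patchE; case: ifPn => [/set_mem[/= _ vB]|_]; first by rewrite mem_set.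
  by case: ifP.
rewrite integral0_eq// => v _; rewrite patchE memNset// => -[/= ? _]; apply: uB.
exact: mem_set.
Qed.

(** The first bound drops the exponential. The second one keeps the decay
    [|z1 - z2| ^- th] in space, at the price of a factor [s ^ (al th / 2)]; the
    integral over the second ball is then [average_rpow]. *)
Lemma rect_mass n (N ga al th C c : R) : (0 < n)%N -> 0 < C -> 0 < c -> 0 < th -> th < n%:R ->
  exists2 A0 : R, 0 < A0 &
  forall (nu : set ('rV[R]_n * 'rV[R]_n) -> \bar R) p s, 0 < s ->
  has_density (lebesgue_rV R n \x lebesgue_rV R n)%E nu p ->
  (forall z1 z2, cube N z1 -> cube N z2 -> p (z1, z2) <=
     C / s `^ ga * expR (- (c * enorm (z1 - z2) ^+ 2 / s `^ al))) ->
  forall z1 z2 e, 0 < e ->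
  (nu (clipped N z1 e `*` clipped N z2 e) <= (A0 * (e ^+ n) ^+ 2 * s `^ (- ga))%:E)%E /\
  (nu (clipped N z1 e `*` clipped N z2 e) <=
    (A0 * (e ^+ n) ^+ 2 * (Num.max `|z2 - z1| e `^ (- th) * s `^ (- (ga - al * th / 2))))%:E)%E.
Proof.
move=> n0 C0 c0 th0 thn.
have [M M0 hM] := exp_le_rpow al c0 th0.
have [C1 C10 hC1] := average_rpow n0 (ltW th0) thn.
pose X1 := C * 4 ^+ n * 4 ^+ n; pose X2 := C * M * C1 * 4 ^+ n.
have X10 : 0 < X1 by apply: mulr_gt0; [apply: mulr_gt0 => //|]; exact: exprn_gt0.
have X20 : 0 < X2 by apply: mulr_gt0; [do 2 apply: mulr_gt0 => //|exact: exprn_gt0].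
exists (X1 + X2); first exact: addr_gt0.
move=> nu p s s0 dnu pb z1 z2 e e0.
have mB (z : 'rV[R]_n) := measurable_clipped N z e.
have en0 : 0 <= (e ^+ n) ^+ 2 by exact: sqr_ge0.
split.
  have K0 : 0 <= C * s `^ (- ga) by rewrite mulr_ge0 ?powR_ge0// ltW.
  apply: le_trans (density_rect_le (h := fun=> (C * s `^ (- ga))%:E) dnu (mB z1) (mB z2) _ _ _) _ => //.
    move=> u v [uN _] [vN _]; rewrite lee_fin; apply: le_trans (pb _ _ uN vN) _.
    rewrite powRN ler_piMr ?mulr_ge0 ?invr_ge0 ?powR_ge0 ?(ltW C0)//.
    by rewrite -expR0 ler_expR oppr_le0 !mulr_ge0 ?invr_ge0 ?powR_ge0 ?enorm_ge0 ?(ltW c0).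
  apply: (@le_trans _ _ (\int[lebesgue_rV R n]_(u in clipped N z1 e)
      (C * s `^ (- ga) * (4 * e) ^+ n)%:E)%E).
    apply: ge0_integral_mono => u _; first by apply: integral_ge0 => v _; rewrite lee_fin.
    rewrite integral_cst// [X in (_ <= X)%E]EFinM.
    by apply: lee_wpmul2l; [rewrite lee_fin|exact: lebesgue_clipped_le].
  rewrite integral_cst//.
  apply: (@le_trans _ _ ((C * s `^ (- ga) * (4 * e) ^+ n)%:E * ((4 * e) ^+ n)%:E)%E).
    apply: lee_wpmul2l; last exact: lebesgue_clipped_le.
    by rewrite lee_fin; apply: mulr_ge0 => //; rewrite exprn_ge0// mulr_ge0// ltW.
  rewrite -!EFinM lee_fin.
  rewrite [leLHS](_ : _ = X1 * (e ^+ n) ^+ 2 * s `^ (- ga)); last first.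
    by rewrite /X1 !exprMn; ring.
  by rewrite ler_wpM2r ?powR_ge0// ler_wpM2r// lerDl ltW.
set q := Num.max _ _.
pose K := C * M * s `^ (- (ga - al * th / 2)).
have K0 : 0 <= K by rewrite mulr_ge0 ?powR_ge0// mulr_ge0// ltW.
have mr : measurable_fun setT (fun r : 'rV[R]_n * 'rV[R]_n => rpow th `|r.2 - r.1|).
  exact: measurable_rpow_dist.
apply: le_trans (density_rect_le (h := fun r => (K%:E * rpow th `|(r.2 - r.1)%R|)%E) dnu (mB z1) (mB z2) _ _ _) _.
- exact: measurable_funeM.
- by move=> r; rewrite mule_ge0 ?rpow_ge0// lee_fin.
- move=> u v [uN _] [vN _] /=.
  have [uv|uv] := eqVneq v u.
    rewrite uv subrr normr0 /rpow eqxx gt0_muley ?leey// lte_fin.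
    by rewrite mulr_gt0 ?powR_gt0// mulr_gt0.
  have uv0 : 0 < `|v - u| by rewrite normr_gt0 subr_eq0.
  have uv1 : `|v - u| <= enorm (u - v) by rewrite distrC; exact: mxnorm_le_enorm.
  have uv2 : 0 < enorm (u - v) by exact: lt_le_trans uv1.
  rewrite rpowE ?gt_eqF// -EFinM lee_fin; apply: le_trans (pb _ _ uN vN) _.
  have Cs : 0 <= C / s `^ ga by rewrite mulr_ge0 ?invr_ge0 ?powR_ge0// ltW.
  apply: le_trans (ler_wpM2l Cs (hM _ _ uv2 s0)) _.
  have -> : K = C / s `^ ga * M * s `^ (al * th / 2).
    rewrite /K opprB powRD ?(gt_eqF s0) ?implybT// powRN; ring.
  rewrite mulrA [C / s `^ ga * (M * _)]mulrA ler_wpM2l//.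
    by rewrite !mulr_ge0 ?invr_ge0 ?powR_ge0// ltW.
  rewrite !powRN lef_pV2 ?posrE ?powR_gt0//.
  by apply: ge0_ler_powR; rewrite ?nnegrE ?(ltW th0) ?(ltW uv0) ?(ltW uv2).
apply: (@le_trans _ _ (\int[lebesgue_rV R n]_(u in clipped N z1 e) (K * (C1 * e ^+ n * q `^ (- th)))%:E)%E).
  apply: ge0_integral_mono => u [uN uz].
    by apply: integral_ge0 => v _; rewrite mule_ge0 ?rpow_ge0// lee_fin.
  have mru : measurable_fun setT (fun v : 'rV[R]_n => rpow th `|v - u|).
    exact: measurable_rpow_dist.
  rewrite ge0_integralZl//; last 2 first.
  - exact: measurable_funTS.
  - by move=> v _; exact: rpow_ge0.
  rewrite [X in (_ <= X)%E]EFinM; apply: lee_wpmul2l; first by rewrite lee_fin.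
  apply: le_trans (hC1 z1 z2 u e e0 uz).
  apply: ge0_subset_integral => //.
  - exact: measurable_cball.
  - exact: measurable_funTS.
  - by move=> v _; exact: rpow_ge0.
  - exact: subIsetr.
rewrite integral_cst//.
have Y0 : 0 <= K * (C1 * e ^+ n * q `^ (- th)).
  by rewrite mulr_ge0// !mulr_ge0 ?powR_ge0 ?exprn_ge0 ?(ltW C10) ?(ltW e0).
apply: (@le_trans _ _ ((K * (C1 * e ^+ n * q `^ (- th)))%:E * ((4 * e) ^+ n)%:E)%E).
  by apply: lee_wpmul2l; [rewrite lee_fin|exact: lebesgue_clipped_le].
rewrite -EFinM lee_fin.
rewrite [leLHS](_ : _ = X2 * (e ^+ n) ^+ 2 * (q `^ (- th) * s `^ (- (ga - al * th / 2)))); last first.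
  by rewrite /K /X2 !exprMn; ring.
by rewrite ler_wpM2r ?mulr_ge0 ?powR_ge0// ler_wpM2r// lerDr ltW.
Qed.

End pair_estimates.

(** * Time spent near a compact set *)

Section space_time.
Context {R : realType} {m d : nat} (mu : probability 'rV[R]_d R).

Definition space_time : set ('rV[R]_m * 'rV[R]_d) -> \bar R :=
  (lebesgue_rV R m \x mu)%E.

HB.instance Definition _ := Measure.on space_time.

Let space_time_sigma_finite : sigma_finite setT space_time.
Proof.
exists (fun n => cball 0 n.+1%:R `*` setT).
  apply/esym/seteqP; split => // -[x z] _.
  exists (Num.truncn `|x|) => //; split => //; rewrite /cball/= subr0.
  by have /andP[_ /ltW] := truncn_itv (normr_ge0 x).
move=> n; split; first by apply: measurableX => //; exact: measurable_cball.
rewrite /space_time product_measure1E//; last exact: measurable_cball.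
rewrite [X in (_ * X)%E]probability_setT mule1.
by apply: le_lt_trans (lebesgue_cball_le _ _) _ => //; rewrite ltey.
Qed.

HB.instance Definition _ := @Measure_isSigmaFinite.Build _ _ _ space_time
  space_time_sigma_finite.

Lemma space_timeX A B : measurable A -> measurable B ->
  space_time (A `*` B) = (lebesgue_rV R m A * mu B)%E.
Proof. by move=> mA mB; rewrite /space_time product_measure1E. Qed.

Lemma integral_space_time (f : 'rV[R]_m * 'rV[R]_d -> \bar R) : measurable_fun setT f ->
  (forall t, 0 <= f t)%E ->
  (\int[space_time]_t f t = \int[lebesgue_rV R m]_x \int[mu]_z f (x, z))%E.
Proof. by move=> mf f0; exact: (fubini_tonelli1 (m1 := lebesgue_rV R m) (m2 := mu)). Qed.

Lemma integral_space_time_swap (f : 'rV[R]_m * 'rV[R]_d -> \bar R) : measurable_fun setT f ->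
  (forall t, 0 <= f t)%E ->
  (\int[space_time]_t f t = \int[mu]_z \int[lebesgue_rV R m]_x f (x, z))%E.
Proof. by move=> mf f0; exact: (fubini_tonelli2 (m1 := lebesgue_rV R m) (m2 := mu)). Qed.

End space_time.

Section process.
Context {R : realType} {m d : nat} {disp : measure_display} {Omega : measurableType disp}.
Context {P : probability Omega R} (v : 'rV[R]_m -> {RV P >-> 'rV[R]_d}).
Context (v_cont : forall w : Omega, continuous (fun x : 'rV[R]_m => v x w)).

Lemma closed_clipped n N (z : 'rV[R]_n) e : closed (clipped N z e).
Proof.
apply: closedI.
  by apply: compact_closed; [exact: norm_hausdorff|exact: compact_cube].
rewrite (_ : cball z e = (fun y => `|y - z| : R) @^-1` `]-oo, e]%classic); last first.
  by apply/seteqP; split => y; rewrite /cball/= in_itv.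
apply: closed_comp; last exact: interval_closed.
move=> x _; apply: continuous_comp; last exact: norm_continuous.
by apply: continuousB; [exact: cvg_id|exact: cst_continuous].
Qed.

(** The lower bound on the density may depend on the time in an arbitrary way. The
    set of times with constant [1 / (k + 1)] is nevertheless closed, by
    [closed_prob_ge], and these sets cover [I], so one of them has positive
    measure. *)
Lemma good_times (I : set 'rV[R]_m) (N : R) :
  compact I -> (0 < lebesgue_rV R m I)%E -> 0 < N ->
  (forall x, I x -> exists2 c0 : R, 0 < c0 & forall z e, cube N z -> 0 < e -> e <= N ->
    ((c0 * e ^+ d)%:E <= P (v x @^-1` clipped N z e))%E) ->
  exists2 del : R, 0 < del & exists J : set 'rV[R]_m, [/\ measurable J, J `<=` I,
    (0 < lebesgue_rV R m J)%E, (lebesgue_rV R m J < +oo)%E &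
    forall x z e, J x -> cube N z -> 0 < e -> e <= N ->
      ((del * e ^+ d)%:E <= P (v x @^-1` clipped N z e))%E].
Proof.
move=> cI I0 N0 hI.
pose J (k : nat) := I `&` \bigcap_(p in [set p : 'rV[R]_d * R | cube N p.1 /\ 0 < p.2 <= N])
  [set x | ((k.+1%:R^-1 * p.2 ^+ d)%:E <= P (v x @^-1` clipped N p.1 p.2))%E].
have clI : closed I by apply: compact_closed => //; exact: norm_hausdorff.
have mJ k : measurable (J k).
  apply: closed_measurable_rV; apply: closedI => //; apply: closed_bigI => p _.
  apply: (@closed_prob_ge _ _ _ P _ _ (fun x => v x)) => //; exact: closed_clipped.
have IJ : I `<=` \bigcup_k J k.
  move=> x Ix; have [c0 c00 hc] := hI x Ix.
  exists (Num.truncn c0^-1) => //; split => // -[z e] /= [zN /andP[e0 eN]].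
  apply: le_trans (hc z e zN e0 eN); rewrite lee_fin ler_wpM2r ?exprn_ge0 ?(ltW e0)//.
  rewrite invf_ple ?posrE//.
  have i0 : 0 <= c0^-1 by rewrite invr_ge0 ltW.
  by have /andP[_ /ltW] := truncn_itv i0.
have [k Jk] : exists k, (0 < lebesgue_rV R m (J k))%E.
  apply: contrapT => /forallNP H.
  have J0 k : lebesgue_rV R m (J k) = 0%E.
    by apply/eqP; rewrite eq_le measure_ge0 andbT leNgt; exact/negP/H.
  move: I0; rewrite ltNge => /negP; apply.
  have mI : measurable I by exact: closed_measurable_rV.
  have := measure_sigma_subadditive (lebesgue_rV R m) mJ mI IJ.
  by rewrite eseries0// => i _ _; exact: J0.
have [M IM] : exists M : R, 0 < M /\ I `<=` cball 0 M.
  have /ex_strict_bound_gt0[M M0 hM] := compact_bounded cI.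
  by exists M; split => // x Ix; rewrite /cball/= subr0 ltW// hM.
exists k.+1%:R^-1; first by rewrite invr_gt0.
exists (J k); split => //; first exact: subIsetl.
  apply: (@le_lt_trans _ _ (lebesgue_rV R m (cball 0 M))).
    apply: le_measure; rewrite ?inE//; first exact: measurable_cball.
    by apply: subset_trans IM.2; exact: subIsetl.
  by apply: le_lt_trans (lebesgue_cball_le _ IM.1) _; rewrite ltey.
by move=> x z e [_ Jx] zN e0 eN; apply: (Jx (z, e)); split => //=; rewrite e0.
Qed.

Lemma clip_prob_ge (p : 'rV[R]_d -> R) (N c0 : R) x : has_density (lebesgue_rV R d) (distribution P (v x)) p ->
  0 < c0 -> (forall w, cube N w -> c0 <= p w) -> forall z e, cube N z -> 0 < e -> e <= N ->
    ((c0 * e ^+ d)%:E <= P (v x @^-1` clipped N z e))%E.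
Proof.
move=> [mp p0 dp] c00 cp z e zN e0 eN.
have -> : P (v x @^-1` clipped N z e) = distribution P (v x) (clipped N z e) by [].
rewrite dp; last exact: measurable_clipped.
apply: (@le_trans _ _ (\int[lebesgue_rV R d]_(z in clipped N z e) c0%:E)%E); last first.
  apply: ge0_integral_mono => w [wN _]; first by rewrite lee_fin ltW.
  by rewrite lee_fin cp.
rewrite integral_cst; last exact: measurable_clipped.
rewrite EFinM; apply: lee_wpmul2l; first by rewrite lee_fin ltW.
exact: lebesgue_cube_cball_ge.
Qed.

Definition hits (J : set 'rV[R]_m) (F : set 'rV[R]_d) (N e : R) :
    set (('rV[R]_m * 'rV[R]_d) * Omega) :=
  [set q | J q.1.1 /\ F q.1.2 /\ clipped N q.1.2 e (v q.1.1 q.2)].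

(** The event that the random variable of the second moment argument is positive;
    on it the path over [J] comes within distance [e] of [F]. *)
Definition hit_event (mu : probability 'rV[R]_d R) J F N e : set Omega :=
  [set w | (0 < space_time mu (ysection (hits J F N e) w))%E].

Lemma measurable_hits J F N e : measurable J -> measurable F -> measurable (hits J F N e).
Proof.
move=> mJ mF.
have mv : measurable_fun setT (fun q : ('rV[R]_m * 'rV[R]_d) * Omega => v q.1.1 q.2).
  have := @measurable_fun_joint R _ _ _ _ (fun x => v x) (fun x => measurable_funPT (v x)) v_cont.
  move=> mvj.
  pose g (q : ('rV[R]_m * 'rV[R]_d) * Omega) : 'rV[R]_m * Omega := (q.1.1, q.2).
  suff mg : measurable_fun setT g by exact: (measurableT_comp mvj mg).
  apply/measurable_fun_pairP; split; first exact: (measurableT_comp measurable_fst measurable_fst).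
  exact: measurable_snd.
have -> : hits J F N e = ((J `*` F) `*` setT) `&` ((fun q => v q.1.1 q.2) @^-1` cube N `&`
    (fun q => `|v q.1.1 q.2 - q.1.2| : R) @^-1` `]-oo, e]%classic).
  apply/seteqP; split => q; rewrite /hits/=/clipped/cball/= in_itv/=.
    by move=> [? [? []]].
  by move=> [[[]]] ? ? _ [].
apply: measurableI.
  by apply: measurableX => //; exact: measurableX.
apply: measurableI; rewrite -[X in measurable X]setTI.
  by apply: mv => //; exact: measurable_cube.
apply: measurable_fun_dist => //.
exact: (measurableT_comp measurable_snd measurable_fst).
Qed.

Lemma measurable_hit_event mu J F N e : measurable J -> measurable F ->
  measurable (hit_event mu J F N e).
Proof.
move=> mJ mF.
have mh : measurable_fun setT (fun w => space_time mu (ysection (hits J F N e) w)).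
  exact: (measurable_fun_ysection (@space_time R m d mu) (measurable_hits N e mJ mF)).
rewrite (_ : hit_event _ _ _ _ _ =
  (fun w => space_time mu (ysection (hits J F N e) w)) @^-1` `]0%E, +oo[%classic).
  by rewrite -[X in measurable X]setTI; apply: mh => //; exact: emeasurable_itv.
by apply/seteqP; split => w; rewrite /hit_event /= in_itv/= andbT.
Qed.

Lemma xsection_hits J F N e x z : J x -> F z ->
  xsection (hits J F N e) (x, z) = v x @^-1` clipped N z e.
Proof.
move=> Jx Fz; apply/seteqP; split => w; rewrite /xsection/= inE.
  by move=> [_ [_]].
by move=> h; split.
Qed.

Lemma xsection_hits0 J F N e x z : ~ (J x /\ F z) ->
  xsection (hits J F N e) (x, z) = set0.
Proof.
by move=> h; apply/seteqP; split => w; rewrite /xsection/= ?inE// => -[? [? _]]; apply: h.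
Qed.

(** The second moment inequality for the product of Lebesgue measure on [J] and
    [mu] on [F]. The factors [(e ^ d) ^ 2] of both moments cancel, so that the
    bound does not depend on [e]. *)
Lemma hit_prob (mu : probability 'rV[R]_d R) (J : set 'rV[R]_m) (F : set 'rV[R]_d)
  (N del A0 L f E e : R) (K : 'rV[R]_d -> 'rV[R]_d -> \bar R) :
  measurable J -> measurable F -> 0 < e -> 0 < del -> 0 < A0 -> 0 <= E ->
  lebesgue_rV R m J = L%:E -> mu F = f%:E ->
  (forall x z, J x -> F z -> ((del * e ^+ d)%:E <= P (v x @^-1` clipped N z e))%E) ->
  measurable_fun setT (fun p : 'rV[R]_d * 'rV[R]_d => K p.1 p.2) ->
  (forall z1 z2, F z1 -> F z2 -> 0 <= K z1 z2)%E ->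
  (forall x z1 z2, J x -> F z1 -> F z2 ->
    (\int[lebesgue_rV R m]_(y in J)
       P (v x @^-1` clipped N z1 e `&` v y @^-1` clipped N z2 e) <=
     (A0 * (e ^+ d) ^+ 2)%:E * K z1 z2)%E) ->
  (\int[mu]_(z1 in F) \int[mu]_(z2 in F) K z1 z2 <= E%:E)%E ->
  (del * L * f) ^+ 2 <= A0 * L * E * fine (P (hit_event mu J F N e)).
Proof.
move=> mJ mF e0 del0 A00 E0 LJ fF hlow mK K0 hup hE.
have L0 : 0 <= L by rewrite -lee_fin -LJ measure_ge0.
have f0 : 0 <= f by rewrite -lee_fin -fF measure_ge0.
set H := hits J F N e.
have mH : measurable H by exact: measurable_hits.
have ed0 : 0 < e ^+ d by exact: exprn_gt0.
have Pfin : P (hit_event mu J F N e) \is a fin_num.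
  by apply: fin_num_measure; exact: measurable_hit_event.
pose nu := @space_time R m d mu.
have h1 : ((del * e ^+ d * L * f)%:E <= \int[nu]_t P (xsection H t))%E.
  apply: (@le_trans _ _ (\int[nu]_(t in J `*` F) (del * e ^+ d)%:E)%E).
    rewrite integral_cst; last exact: measurableX.
    by rewrite [X in (_ * X)%E]space_timeX// [X in (_ * (X * _))%E]LJ [X in (_ * (_ * X))%E]fF -!EFinM mulrA.
  rewrite integral_mkcond; apply: ge0_integral_mono => -[x z] _; rewrite patchE; case: ifPn => //.
  - by rewrite lee_fin mulr_ge0// ltW.
  - by move=> /set_mem[/= Jx Fz]; rewrite xsection_hits//; exact: hlow.
  - by move=> _; exact: measure_ge0.
(* K is cut off outside F, where its sign is unknown *)
pose Kf := (fun p : 'rV[R]_d * 'rV[R]_d => K p.1 p.2) \_ (F `*` F).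
have Kf0 p : (0 <= Kf p)%E.
  by rewrite /Kf patchE; case: ifPn => // /set_mem[? ?]; exact: K0.
have mKf : measurable_fun setT Kf.
  apply/(measurable_restrictT _ _).1; first exact: measurableX.
  exact: measurable_funTS.
pose Psi z1 := (\int[mu]_z2 Kf (z1, z2))%E.
have Psi0 z1 : (0 <= Psi z1)%E by apply: integral_ge0 => z2 _; exact: Kf0.
have mPsi : measurable_fun setT Psi by exact: (measurable_fun_fubini_tonelli_F (m2 := mu) Kf mKf Kf0).
have PsiE : (\int[mu]_z1 Psi z1 <= E%:E)%E.
  apply: le_trans hE; rewrite [leRHS]integral_mkcond; apply: ge0_integral_mono => z1 _ //.
  rewrite patchE; case: ifPn => [/set_mem Fz1|nFz1]; last first.
    rewrite /Psi integral0_eq// => z2 _; rewrite /Kf patchE memNset// => -[/= Fz1 _].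
    by move/negP: nFz1; apply; exact: mem_set.
  rewrite [leRHS]integral_mkcond; apply: ge0_integral_mono => z2 _ //.
  rewrite /Kf !patchE; case: ifPn => [/set_mem[_ /= Fz2]|]; first by rewrite mem_set.
  move=> nFF; case: ifPn => // /set_mem Fz2; exact: K0.
pose cc := A0 * (e ^+ d) ^+ 2.
have cc0 : 0 < cc by rewrite mulr_gt0// exprn_gt0.
have h2 : (\int[nu]_t \int[nu]_s P (xsection H t `&` xsection H s) <= (cc * L * E)%:E)%E.
  pose hh (t : 'rV[R]_m * 'rV[R]_d) := (cc%:E * ((\1_J t.1)%:E * Psi t.2))%E.
  have mhh : measurable_fun setT hh.
    apply: measurable_funeM; apply: emeasurable_funM.
      apply/measurable_EFinP; apply: (measurableT_comp (measurable_indic mJ)).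
      exact: measurable_fst.
    exact: (measurableT_comp mPsi measurable_snd).
  have hh0 t : (0 <= hh t)%E by rewrite !mule_ge0// ?lee_fin// ltW.
  apply: (@le_trans _ _ (\int[nu]_t hh t)%E); last first.
    rewrite integral_space_time// /hh/=.
    apply: (@le_trans _ _ (\int[lebesgue_rV R m]_x ((cc * E)%:E * (\1_J x)%:E))%E).
      apply: ge0_integral_mono => x _; first by apply: integral_ge0 => z _; exact: (hh0 (x, z)).
      rewrite ge0_integralZl//; last 3 first.
      - by apply: measurable_funeM.
      - by move=> z _; rewrite mule_ge0// lee_fin.
      - by rewrite lee_fin ltW.
      rewrite [(cc * E)%:E]EFinM -[X in (_ <= X)%E]muleA; apply: lee_wpmul2l; first by rewrite lee_fin ltW.
      rewrite ge0_integralZl// muleC.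
      by apply: lee_wpmul2r; rewrite ?lee_fin.
    rewrite ge0_integralZl//; last 2 first.
    - exact/measurable_EFinP.
    - by rewrite lee_fin mulr_ge0// ltW.
    by rewrite integral_indic// setIT [X in (_ * X)%E]LJ -EFinM lee_fin mulrAC.
  apply: ge0_integral_mono => -[x z1] _; first by apply: integral_ge0.
  have [[Jx Fz1]|nJF] := pselect (J x /\ F z1); last first.
    rewrite integral0_eq ?hh0// => s _.
    by rewrite xsection_hits0// set0I measure0.
  rewrite /hh/= indicE mem_set// mul1e.
  rewrite integral_space_time_swap//; last first.
    pose B := (setT `*` xsection H (x, z1)) `&` H.
    have mB : measurable B.
      apply: measurableI => //; apply: measurableX => //; exact: measurable_xsection.
    rewrite (_ : (fun _ => _) = P \o xsection B); first exact: measurable_fun_xsection.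
    apply/funext => s /=; congr (P _); apply/seteqP; split => w; rewrite /xsection/= !inE.
      by move=> [Hx Hs]; split => //; split => //=; rewrite /xsection/= inE.
    by move=> [[_ /= Hx] Hs]; split => //; move: Hx; rewrite /xsection/= inE.
  rewrite -ge0_integralZl//; last 2 first.
  - exact: (measurableT_comp mKf (measurable_pair1 z1)).
  - by rewrite lee_fin ltW.
  apply: ge0_integral_mono => z2 _; first by apply: integral_ge0.
  have [Fz2|nF] := pselect (F z2); last first.
    rewrite integral0_eq//; first by rewrite mule_ge0// lee_fin ltW.
    move=> y _; rewrite [X in (_ `&` X)]xsection_hits0 ?setI0 ?measure0//.
    by move=> [_ ?].
  rewrite /Kf patchE mem_set//=; apply: le_trans (hup x z1 z2 Jx Fz1 Fz2).
  rewrite [leRHS]integral_mkcond; apply: ge0_integral_mono => y _ //.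
  rewrite patchE; case: ifPn => [/set_mem Jy|nJy]; first by rewrite !xsection_hits.
  rewrite [X in (_ `&` X)]xsection_hits0 ?setI0 ?measure0//.
  by move=> [Jy _]; move/negP: nJy; apply; exact: mem_set.
have e1 : 0 <= del * e ^+ d * L * f by rewrite !mulr_ge0 ?(ltW del0) ?(ltW ed0).
have S1 : 0 <= cc * L * E by rewrite !mulr_ge0 ?(ltW A00) ?(ltW ed0).
have h3 : (P [set w | 0 < nu (ysection H w)] <= (fine (P (hit_event mu J F N e)))%:E)%E.
  by rewrite fineK.
have := second_moment mH e1 S1 (fine_ge0 (measure_ge0 P _)) h1 h2 h3.
rewrite (_ : (del * e ^+ d * L * f) ^+ 2 = (e ^+ d) ^+ 2 * (del * L * f) ^+ 2); last by ring.
rewrite (_ : cc * L * E * _ = (e ^+ d) ^+ 2 * (A0 * L * E * fine (P (hit_event mu J F N e)))).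
  by rewrite ler_pM2l// exprn_gt0.
by rewrite /cc; ring.
Qed.

Lemma hit_event_mono mu J F N e e' : e <= e' -> measurable J -> measurable F ->
  hit_event mu J F N e `<=` hit_event mu J F N e'.
Proof.
move=> ee mJ mF w /lt_le_trans; apply; apply: le_measure; rewrite ?inE.
- by apply: measurable_ysection; exact: measurable_hits.
- by apply: measurable_ysection; exact: measurable_hits.
- move=> t; rewrite /ysection/= !inE => -[Jt [Ft [vN ve]]]; split => //; split => //; split => //.
  exact: le_trans ve ee.
Qed.

(** The differences between points of the path and points of [F] form a compact
    set; it contains arbitrarily small vectors, hence 0. *)
Lemma hit_limit mu (I J : set 'rV[R]_m) (F : set 'rV[R]_d) (N : R) :
  compact I -> compact F -> J `<=` I -> 0 < N ->
  \bigcap_n hit_event mu J F N (N / n.+1%:R) `<=`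
  [set w | ((fun x => v x w) @` I) `&` F !=set0].
Proof.
move=> cI cF JI N0 w Gw.
pose M := (fun p : 'rV[R]_m * 'rV[R]_d => v p.1 w - p.2) @` (I `*` F).
have cM : compact M.
  apply: continuous_compact; last exact: compact_setX.
  apply: continuous_subspaceT => p; apply: continuousB; last exact: cvg_snd.
  apply: (@continuous_comp _ _ _ fst (fun x => v x w)); first exact: cvg_fst.
  exact: v_cont.
have [[x z] [/= Ix Fz] xz] : M 0.
  have clM : closed M by apply: compact_closed => //; exact: norm_hausdorff.
  apply: clM => B /nbhs_ballP[r /= r0 rB].
  pose n := Num.truncn (N / r).
  have Nr : N / n.+1%:R < r.
    rewrite ltr_pdivrMr// mulrC -ltr_pdivrMr//.
    have Nr0 : 0 <= N / r by rewrite divr_ge0 ?(ltW N0) ?(ltW r0).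
    by have /andP[] := truncn_itv Nr0.
  have [[[x z]]|] := pselect (ysection (hits J F N (N / n.+1%:R)) w !=set0).
    rewrite /ysection/= inE => -[/= Jx [Fz [_ vz]]].
    exists (v x w - z); split; first by exists (x, z) => //; split => //; exact: JI.
    apply: rB; rewrite -ball_normE/= sub0r normrN; exact: le_lt_trans Nr.
  move=> /set0P/negP/negPn/eqP h; have := Gw n Logic.I.
  by rewrite /hit_event/= h measure0 ltxx.
exists z; split => //; exists x => //.
by apply/eqP; rewrite -subr_eq0; apply/eqP.
Qed.

End process.

(** * Capacity *)

Section capacity.
Context {R : realType}.

(** It suffices to bound every finite energy from below, also when [p = 0]: then
    all energies are infinite and the capacity is 0. *)
Lemma capacity_le n (cstar b k : R) (A : set 'rV[R]_n) (p : \bar R) :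
  0 < k -> (0 <= p)%E -> p \is a fin_num ->
  (forall mu : probability 'rV[R]_n R, mu A = 1%E -> energy cstar b A mu != +oo%E ->
    exists2 E : R, energy cstar b A mu = E%:E & k <= E * fine p) ->
  (k%:E * capacity cstar b A <= p)%E.
Proof.
move=> k0 p0 pfin H; rewrite /capacity.
set S := (X in ereal_inf X).
have [p00|p00] := eqVneq p 0%E.
  rewrite (_ : ereal_inf S = +oo%E); first by rewrite invey mule0.
  apply/ereal_inf_pinfty => _ [mu /= muA <-].
  apply: contrapT => /eqP En; have [E _] := H mu muA En.
  by rewrite p00 mulr0 leNgt k0.
have fp0 : 0 < fine p by rewrite fine_gt0// lt_neqAle eq_sym p00 p0 -ge0_fin_numE.
have inf0 : ((k / fine p)%:E <= ereal_inf S)%E.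
  apply: le_ereal_inf_tmp => _ [mu /= muA <-].
  have [->|En] := eqVneq (energy cstar b A mu) +oo%E; first by rewrite leey.
  have [E -> kE] := H mu muA En.
  by rewrite lee_fin ler_pdivrMr.
have kp0 : 0 < k / fine p by rewrite divr_gt0.
have infp : (0 <= ereal_inf S)%E by apply: le_trans inf0; rewrite lee_fin ltW.
have : ((ereal_inf S)^-1 <= ((k / fine p)%:E)^-1)%E.
  by rewrite lee_pV2//; rewrite inE//= lee_fin ltW.
rewrite inver gt_eqF// invf_div => h.
apply: (@le_trans _ _ (k%:E * (fine p / k)%:E)%E).
  by apply: lee_wpmul2l => //; rewrite lee_fin ltW.
by rewrite -EFinM mulrCA divff ?gt_eqF// mulr1 fineK.
Qed.

Lemma energy_restrict n (cstar b T : R) (A F : set 'rV[R]_n) :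
  measurable A -> measurable F -> F `<=` A -> 0 <= T ->
  (forall z1 z2, A z1 -> A z2 ->
    (0 <= bessel_riesz_kernel cstar b (enorm (z1 - z2)%R))%E) ->
  forall mu : probability 'rV[R]_n R,
  (\int[mu]_(z1 in F) \int[mu]_(z2 in F)
     (T%:E * bessel_riesz_kernel cstar b (enorm (z1 - z2)%R)) <=
   T%:E * energy cstar b A mu)%E.
Proof.
move=> mA mF FA T0 K0 mu.
have mK : measurable_fun setT (fun p : 'rV[R]_n * 'rV[R]_n =>
    bessel_riesz_kernel cstar b (enorm (p.1 - p.2)%R)) by exact: measurable_bessel_dist.
have mK1 z1 : measurable_fun setT (fun z2 : 'rV[R]_n => bessel_riesz_kernel cstar b (enorm (z1 - z2)%R)).
  exact: measurable_bessel_dist.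
pose Phi z1 := (\int[mu]_(z2 in A) bessel_riesz_kernel cstar b (enorm (z1 - z2)%R))%E.
(* the kernel may be negative away from A: it is cut off before Tonelli *)
pose Kf := (fun p : 'rV[R]_n * 'rV[R]_n => bessel_riesz_kernel cstar b (enorm (p.1 - p.2)%R)) \_ (A `*` A).
have Kf0 p : (0 <= Kf p)%E by rewrite /Kf patchE; case: ifPn => // /set_mem[? ?]; exact: K0.
have mKf : measurable_fun setT Kf.
  apply/(measurable_restrictT _ _).1; first exact: measurableX.
  exact: measurable_funTS.
have mPhi : measurable_fun A Phi.
  have mf := measurable_fun_fubini_tonelli_F (m2 := mu) Kf mKf Kf0.
  apply: (eq_measurable_fun (fubini_F mu Kf)); last exact: measurable_funTS.
  move=> z1 /set_mem Az1; rewrite /fubini_F /Phi [RHS]integral_mkcond.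
  apply: eq_integral => z2 _; rewrite /Kf !patchE; case: ifPn => [/set_mem[_ Az2]|h].
    by rewrite mem_set.
  case: ifPn => // /set_mem Az2; case/negP: h; exact: mem_set.
rewrite /energy -ge0_integralZl//; last first.
  by move=> z1 Az1; apply: integral_ge0 => z2 Az2; exact: K0.
apply: (@le_trans _ _ (\int[mu]_(z1 in F) (T%:E * Phi z1))%E).
  apply: ge0_integral_mono => z1 Fz1.
    by apply: integral_ge0 => z2 Fz2; rewrite mule_ge0 ?lee_fin// K0//; exact: FA.
  rewrite ge0_integralZl//; last 2 first.
  - exact: measurable_funTS.
  - by move=> z2 Fz2; apply: K0; exact: FA.
  apply: lee_wpmul2l; first by rewrite lee_fin.
  apply: ge0_subset_integral => //; first exact: measurable_funTS.
  by move=> z2 Az2; apply: K0 => //; exact: FA.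
apply: ge0_subset_integral => //; first exact: measurable_funeM.
move=> z1 Az1; rewrite mule_ge0 ?lee_fin//.
by apply: integral_ge0 => z2 Az2; exact: K0.
Qed.

Lemma inner_prob_ge0 disp (T : measurableType disp) (P : probability T R) E :
  (0 <= inner_prob P E)%E.
Proof.
apply: le_ereal_sup_tmp; exists (P set0); last by rewrite measure0.
by exists set0 => //; split => //; exact: sub0set.
Qed.

Lemma inner_prob_le1 disp (T : measurableType disp) (P : probability T R) E :
  (inner_prob P E <= 1)%E.
Proof. by apply: ge_ereal_sup => _ [B [mB _] <-]; exact: probability_le1. Qed.

End capacity.

Section time_estimate.
Context {R : realType} {m d : nat} {disp : measure_display} {Omega : measurableType disp}.
Context {P : probability Omega R} (v : 'rV[R]_m -> {RV P >-> 'rV[R]_d}).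

(** The order [th] of polynomial decay is taken strictly between [b] and [d], which
    is possible since [b < d]: [th < d] makes the decay integrable in space, and
    [b < th] makes the resulting singularity integrable in time. Taking also
    [th <= 2 gamma / alpha] keeps all powers of the time difference
    nonincreasing. *)
Lemma pair_time_integral (I : set 'rV[R]_m) (N cstar gamma alpha C c : R)
  (p2 : 'rV[R]_m -> 'rV[R]_m -> 'rV[R]_d * 'rV[R]_d -> R) :
  (0 < m)%N -> (0 < d)%N -> compact I -> 0 < N -> 2 * N * Num.sqrt d%:R < cstar ->
  (forall x y, I x -> I y -> x <> y ->
    has_density (lebesgue_rV R d \x lebesgue_rV R d)%E
      (pushforward P (fun w => (v x w, v y w))) (p2 x y)) ->
  0 < gamma -> 0 < alpha -> 0 < C -> 0 < c ->
  (forall x y, I x -> I y -> x <> y ->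
    forall z1 z2 : 'rV[R]_d, cube N z1 -> cube N z2 ->
    p2 x y (z1, z2) <= C / enorm (x - y) `^ gamma *
      expR (- (c * enorm (z1 - z2) ^+ 2 / enorm (x - y) `^ alpha))) ->
  2 / alpha * (gamma - m%:R) < d%:R ->
  exists A0 T : R, [/\ 0 < A0, 0 < T & forall (J : set 'rV[R]_m) x z1 z2 e,
    measurable J -> J `<=` I -> J x -> cube N z1 -> cube N z2 -> 0 < e -> e <= N ->
    (\int[lebesgue_rV R m]_(y in J)
       P (v x @^-1` clipped N z1 e `&` v y @^-1` clipped N z2 e) <=
     (A0 * (e ^+ d) ^+ 2)%:E *
       (T%:E * bessel_riesz_kernel cstar (2 / alpha * (gamma - m%:R)) (enorm (z1 - z2)%R)))%E].
Proof.
move=> m0 d0 cI N0 Nc hd ga0 al0 C0 c0 hb bd.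
set b := 2 / alpha * _ in bd *.
have d0' : 0 < d%:R :> R by rewrite ltr0n.
have bg : b < 2 * gamma / alpha.
  rewrite /b mulrAC ltr_pM2r ?invr_gt0// ltr_pM2l// gtrBl ltr0n//.
pose th := (Num.max b 0 + Num.min d%:R (2 * gamma / alpha)) / 2.
have mM : Num.max b 0 < Num.min d%:R (2 * gamma / alpha).
  by rewrite gt_max !lt_min bd bg d0' divr_gt0// mulr_gt0.
have th1 : Num.max b 0 < th by rewrite /th; lra.
have th2 : th < Num.min d%:R (2 * gamma / alpha) by rewrite /th; lra.
have th0 : 0 < th by apply: le_lt_trans th1; rewrite le_max lexx orbT.
have bth : b < th by apply: le_lt_trans th1; rewrite le_max lexx.
have thd : th < d%:R by apply: lt_le_trans th2 _; rewrite ge_min lexx.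
have thg : alpha * th / 2 <= gamma.
  have : th <= 2 * gamma / alpha by apply: ltW; apply: lt_le_trans th2 _; rewrite ge_min lexx orbT.
  by rewrite ler_pdivlMr// ler_pdivrMr// mulrC [gamma * 2]mulrC.
have [A0 A00 hA0] := rect_mass N gamma alpha d0 C0 c0 th0 thd.
have [M M0 IM] : exists2 M : R, 0 < M & I `<=` cball 0 M.
  have /ex_strict_bound_gt0[M M0 hM] := compact_bounded cI.
  by exists M => // x Ix; rewrite /cball/= subr0 ltW// hM.
have s0 : 0 < Num.sqrt d%:R :> R by rewrite sqrtr_gt0.
have rm0 : 0 < 2 * N * Num.sqrt d%:R by rewrite !mulr_gt0.
have Q0 : 0 < 2 * N by rewrite mulr_gt0.
have D0 : 0 < 2 * M by rewrite mulr_gt0.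
have [T T0 hT] := potential_le_bessel m0 ga0 al0 th0 bth thg rm0 Nc s0 Q0 D0.
exists A0, T; split => // J x z1 z2 e mJ JI Jx z1N z2N e0 eN.
set q := Num.max `|z2 - z1| e.
have q0 : 0 < q by rewrite lt_max e0 orbT.
have ed0 : 0 < (e ^+ d) ^+ 2 by rewrite !exprn_gt0.
have Ae0 : 0 < A0 * (e ^+ d) ^+ 2 by rewrite mulr_gt0.
have rho0 : 0 < q `^ (2 / alpha) by rewrite powR_gt0.
have Z0 : 0 < q `^ (- th) by rewrite powR_gt0.
pose g y := P (v x @^-1` clipped N z1 e `&` v y @^-1` clipped N z2 e).
have key y : J y -> y <> x ->
    (g y <= (A0 * (e ^+ d) ^+ 2 * `|y - x| `^ (- gamma))%:E)%E /\
    (g y <= (A0 * (e ^+ d) ^+ 2 * (q `^ (- th) * `|y - x| `^ (- (gamma - alpha * th / 2))))%:E)%E.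
  move=> Jy yx.
  have xy : x <> y by move=> /esym.
  have S0 : 0 < `|y - x| by rewrite normr_gt0 subr_eq0; exact/eqP.
  have Ss : `|y - x| <= enorm (x - y) by rewrite distrC; exact: mxnorm_le_enorm.
  have ss0 : 0 < enorm (x - y) by exact: lt_le_trans Ss.
  have [h1 h2] := hA0 _ _ _ ss0 (hd x y (JI _ Jx) (JI _ Jy) xy)
    (hb x y (JI _ Jx) (JI _ Jy) xy) z1 z2 e e0.
  have pw (a : R) : 0 <= a -> enorm (x - y) `^ (- a) <= `|y - x| `^ (- a).
    move=> a0; rewrite !powRN lef_pV2 ?posrE ?powR_gt0//.
    by apply: ge0_ler_powR; rewrite ?nnegrE ?(ltW S0) ?(ltW ss0).
  split.
    apply: le_trans h1 _; rewrite lee_fin ler_wpM2l ?(ltW Ae0)//.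
    by apply: pw; exact: ltW.
  apply: le_trans h2 _; rewrite lee_fin ler_wpM2l ?(ltW Ae0)// ler_wpM2l ?(ltW Z0)//.
  by apply: pw; rewrite subr_ge0.
have JD : J `<=` cball x (2 * M).
  move=> y Jy; have := IM _ (JI _ Jy); have := IM _ (JI _ Jx); rewrite /cball/= !subr0 => hx hy.
  by apply: le_trans (ler_normB _ _) _; rewrite mulr_natl mulr2n lerD.
apply: le_trans (time_integral_le (g := g) Ae0 rho0 Z0 JD _ (fun y Jy yx => (key y Jy yx).1) (fun y Jy yx => (key y Jy yx).2)) _ => //.
apply: lee_wpmul2l; first by rewrite lee_fin ltW.
apply: hT => //.
- by rewrite ge_max cube_dist ?(ltW N0)//=; lra.
- exact: enorm_ge0.
- by apply: cube_edist => //; exact: ltW.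
- apply: le_trans (enorm_le_mxnorm _) _; rewrite ler_wpM2l ?sqrtr_ge0//.
  by rewrite le_max distrC lexx.
Qed.

Lemma density_lower_bound (N : R) (p : 'rV[R]_d -> R) : 0 < N ->
  [/\ continuous p, [bounded p w | w in [set: 'rV[R]_d]] &
           forall w, cube (N + 1) w -> 0 < p w]
  \/ (forall K : set 'rV[R]_d, compact K ->
       exists2 c0 : R, 0 < c0 & (c0%:E <= ereal_inf [set (p w)%:E | w in K])%E) ->
  exists2 c0 : R, 0 < c0 & forall w, cube N w -> c0 <= p w.
Proof.
move=> N0 [[cp _ pp]|H]; last first.
  have [c0 c00 hc] := H _ (@compact_cube R d N); exists c0 => // w wN.
  by rewrite -lee_fin; apply: le_trans hc _; apply: ereal_inf_lbound; exists w.
have cube0 : @cube R d N !=set0.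
  by exists (0 : 'rV[R]_d) => i; rewrite mxE; lra.
have [w wN hw] := EVT_min_rV cube0 (@compact_cube R d N) (continuous_subspaceT cp).
exists (p w); last by move=> u uN; apply: hw; rewrite inE.
by apply: pp => i; move: wN; rewrite inE => /(_ i); lra.
Qed.

End time_estimate.

Unset Implicit Arguments.
Set Strict Implicit.

Theorem theorem2p1 (R : realType) (m d : nat) (m_ge1 : (1 <= m)%N)
  (d_ge1 : (1 <= d)%N)
  (disp : measure_display) (Omega : measurableType disp)
  (P : probability Omega R)
  (v : 'rV[R]_m -> {RV P >-> 'rV[R]_d})
  (v_cont : forall w : Omega, continuous (fun x : 'rV[R]_m => v x w))
  (I : set 'rV[R]_m) (I_compact : compact I)
  (I_pos : (0 < lebesgue_rV R m I)%E)
  (N : R) (N_gt0 : 0 < N)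
  (cstar : R) (cstar_large : 2 * N * Num.sqrt d%:R < cstar)
  (p2 : 'rV[R]_m -> 'rV[R]_m -> 'rV[R]_d * 'rV[R]_d -> R)
  (p2_density : forall x y, I x -> I y -> x <> y ->
    has_density (lebesgue_rV R d \x lebesgue_rV R d)%E
      (pushforward P (fun w => (v x w, v y w))) (p2 x y))
  (gamma alpha : R) (gamma_gt0 : 0 < gamma) (alpha_gt0 : 0 < alpha)
  (C c : R) (C_gt0 : 0 < C) (c_gt0 : 0 < c)
  (p2_bound : forall x y, I x -> I y -> x <> y ->
    forall z1 z2 : 'rV[R]_d, cube N z1 -> cube N z2 ->
    p2 x y (z1, z2) <= C / enorm (x - y) `^ gamma *
      expR (- (c * enorm (z1 - z2) ^+ 2 / enorm (x - y) `^ alpha)))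
  (p1 : 'rV[R]_m -> 'rV[R]_d -> R)
  (p1_density : forall x, I x ->
    has_density (lebesgue_rV R d) (distribution P (v x)) (p1 x))
  (p1_bound :
    (forall x, I x ->
       [/\ continuous (p1 x), [bounded p1 x w | w in [set: 'rV[R]_d]] &
           forall w, cube (N + 1) w -> 0 < p1 x w])
    \/
    (forall K : set 'rV[R]_d, compact K -> forall x, I x ->
       exists2 c0 : R, 0 < c0 &
         (c0%:E <= ereal_inf [set (p1 x w)%:E | w in K])%E)) :
  exists2 k : R, 0 < k &
    forall A : set 'rV[R]_d, measurable A -> A `<=` cube N ->
      (k%:E * capacity cstar (2 / alpha * (gamma - m%:R)) A <=
       inner_prob P
         [set w | ((fun x => v x w) @` I) `&` A !=set0])%E.
Proof.
pose b : R := 2 / alpha * (gamma - m%:R).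
have [db|bd] := leP d%:R b.
  exists 1 => // A mA AN; rewrite mul1e.
  rewrite -[X in (X <= _)%E]mul1e.
  apply: capacity_le => //; first exact: inner_prob_ge0.
    rewrite ge0_fin_numE; last exact: inner_prob_ge0.
    by apply: le_lt_trans (inner_prob_le1 _ _) _; rewrite ltey.
  by move=> mu muA; rewrite (energy_ge_dim cstar d_ge1 N_gt0 mA AN muA db) eqxx.
have [del del0 [J [mJ JI J0 Joo hJ]]] : exists2 del : R, 0 < del & exists J : set 'rV[R]_m,
    [/\ measurable J, J `<=` I, (0 < lebesgue_rV R m J)%E, (lebesgue_rV R m J < +oo)%E &
    forall x z e, J x -> cube N z -> 0 < e -> e <= N ->
      ((del * e ^+ d)%:E <= P (v x @^-1` clipped N z e))%E].
  apply: good_times => // x Ix.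
  have [|c0 c00 hc] := @density_lower_bound R d N (p1 x) N_gt0.
    by case: p1_bound => h; [left; exact: h|right => K cK; exact: h].
  by exists c0 => // z e zN e0 eN; exact: (clip_prob_ge (p1_density x Ix) c00 hc zN e0 eN).
have [A0 [T [A00 T0 hA]]] := pair_time_integral m_ge1 d_ge1 I_compact N_gt0 cstar_large
  p2_density gamma_gt0 alpha_gt0 C_gt0 c_gt0 p2_bound bd.
have Jfin : lebesgue_rV R m J \is a fin_num by rewrite ge0_fin_numE.
pose L := fine (lebesgue_rV R m J).
have L0 : 0 < L by rewrite /L fine_gt0// J0.
have LE : lebesgue_rV R m J = L%:E by rewrite fineK.
pose k := del ^+ 2 * L / (4 * A0 * T).
have k0 : 0 < k by rewrite divr_gt0 ?mulr_gt0// exprn_gt0.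
exists k => // A mA AN.
have ip0 := @inner_prob_ge0 R _ _ P.
have ipfin E : inner_prob P E \is a fin_num.
  by rewrite ge0_fin_numE//; apply: le_lt_trans (inner_prob_le1 _ _) _; rewrite ltey.
apply: capacity_le => // mu muA Eoo.
have K0 z1 z2 : A z1 -> A z2 -> (0 <= bessel_riesz_kernel cstar b (enorm (z1 - z2)%R))%E.
  by move=> Az1 Az2; apply: (bessel_riesz_ge0 _ (ltW N_gt0) cstar_large); exact: AN.
have Epos : (0 <= energy cstar b A mu)%E.
  by apply: integral_ge0 => z1 Az1; apply: integral_ge0 => z2 Az2; exact: K0.
have Efin : energy cstar b A mu \is a fin_num by rewrite ge0_fin_numE// ltey.
pose E := fine (energy cstar b A mu).
have E0 : 0 <= E by rewrite /E fine_ge0.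
exists E; first by rewrite fineK.
have h2 : 0 < 2^-1 :> R by rewrite invr_gt0.
have [F [cF FA muF]] := compact_approx mu mA AN h2.
have mF : measurable F by apply: closed_measurable_rV; apply: compact_closed => //; exact: norm_hausdorff.
have muFfin : mu F \is a fin_num by exact: fin_num_measure.
pose f := fine (mu F).
have fE : mu F = f%:E by rewrite fineK.
have f2 : 2^-1 <= f.
  by move: muF; rewrite [X in (X <= _)%E]muA [X in (_ <= X + _)%E]fE -EFinD lee_fin; lra.
have FN : F `<=` cube N by exact: subset_trans AN.
pose G n := hit_event v mu J F N (N / n.+1%:R).
have e0 n : 0 < N / n.+1%:R by rewrite divr_gt0.
have eN n : N / n.+1%:R <= N by rewrite ler_pdivrMr// ler_peMr ?(ltW N_gt0)// ler1n.
have mG n : measurable (G n) by exact: measurable_hit_event.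
have Gk n : k <= E * fine (P (G n)).
  have := @hit_prob R m d _ _ P v v_cont mu J F N del A0 L f (T * E) (N / n.+1%:R)
    (fun z1 z2 => T%:E * bessel_riesz_kernel cstar b (enorm (z1 - z2)%R))%E
    mJ mF (e0 n) del0 A00 (mulr_ge0 (ltW T0) E0) LE fE.
  have := energy_restrict mA mF FA (ltW T0) K0 mu.
  rewrite -(fineK Efin) -EFinM => hE.
  move=> /(_ _ _ _ _ hE) H; have {H} : (del * L * f) ^+ 2 <= A0 * L * (T * E) * fine (P (G n)).
    apply: H.
    - by move=> x z Jx Fz; apply: hJ => //; exact: FN.
    - by apply: measurable_funeM; exact: measurable_bessel_dist.
    - by move=> z1 z2 Fz1 Fz2; rewrite mule_ge0 ?lee_fin ?(ltW T0)// K0//; exact: FA.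
    - by move=> x z1 z2 Jx Fz1 Fz2; apply: hA => //; exact: FN.
  have : del ^+ 2 * L ^+ 2 / 4 <= (del * L * f) ^+ 2.
    rewrite !exprMn; apply: ler_wpM2l; first by rewrite mulr_ge0 ?sqr_ge0.
    rewrite (_ : 4^-1 = 2^-1 ^+ 2); last by rewrite exprVn -natrX.
    by rewrite lerXn2r ?nnegrE ?(ltW h2)// (le_trans (ltW h2)).
  move=> /le_trans h /h {h}; move: (fine (P (G n))) => p hp.
  rewrite /k ler_pdivrMr ?mulr_gt0//; have L4 : 0 < L / 4 by rewrite divr_gt0.
  rewrite -(ler_pM2l L4).
  have -> : L / 4 * (del ^+ 2 * L) = del ^+ 2 * L ^+ 2 / 4 by ring.
  by have -> : L / 4 * (E * p * (4 * A0 * T)) = A0 * L * (T * E) * p by field.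
have Epos' : 0 < E.
  rewrite lt_neqAle E0 andbT eq_sym; apply/eqP => E00.
  by move: (Gk 0%N); rewrite E00 mul0r leNgt k0.
have PG n : ((k / E)%:E <= P (G n))%E.
  have Gfin : P (G n) \is a fin_num by exact: fin_num_measure.
  by rewrite -(fineK Gfin) lee_fin ler_pdivrMr// mulrC.
rewrite mulrC -ler_pdivrMr// -lee_fin fineK//.
apply: (@le_trans _ _ (P (\bigcap_n G n))).
  apply: le_measure_bigcap => //.
  apply/nonincreasing_seqP => n; apply/subsetPset; apply: hit_event_mono => //.
  by rewrite ler_wpM2l ?(ltW N_gt0)// lef_pV2 ?posrE// ler_nat.
apply: ereal_sup_ubound; exists (\bigcap_n G n) => //; split.
  exact: bigcapT_measurable.
move=> w /(hit_limit v_cont I_compact cF JI N_gt0) [z [Iz Fz]].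
by exists z; split => //; exact: FA.
Qed.
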